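(* Let $T\colon[0,1]\to[0,1]$ be piecewise monotonic, let $\eta$ be a $T$-invariant Borel probability measure with respect to which $T$ is mixing, and suppose the Perron–Frobenius operator $P$ of $T$ satisfies the spectral decomposition hypothesis below (with $\eta=h\Lambda$). Let $f\in\mathrm{BV}$ be non-negative and bounded, and for $y\in[0,1]$ let $\mu_y=\sum_{n\in\mathbb{N}_0} f(T^n(y))\,\delta_n$ be the $f$-weighted return time measure. Define $c_0=\int f^2\,d\eta-\left(\int f\,d\eta\right)^2$ and $c_z=\int \Psi^{|z|}(f\cdot h)\,f\,d\Lambda$ for $z\in\mathbb{Z}\setminus\{0\}$. Then for $\eta$-almost every $y$ the autocorrelation of $\mu_y$ exists and satisfies $$2\gamma_{\mu_y}=\Big(\int f\,d\eta\Big)^2\sum_{z\in\mathbb{Z}}\delta_z+\sum_{z\in\mathbb{Z}}c_z\,\delta_z,$$ and its diffraction is $$\widehat{\gamma_{\mu_y}}=\frac12\Big(\int f\,d\eta\Big)^2\delta_1+g\,\omega_{\mathbb{T}},\qquad g(x)=\sum_{z\in\mathbb{Z}}\frac{c_z}{2}\,x^z\quad (x\in\mathbb{T}),$$ where the series defining $g$ converges absolutely and uniformly.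
   Context: $T$ is piecewise monotonic if there is a finite partition $\mathscr{I}$ of $[0,1]$ into intervals such that for each $I\in\mathscr{I}$ the restriction $T|_I$ is continuous, strictly monotone and differentiable. $T$ is mixing w.r.t. $\eta$ if $\eta(T^{-n}A\cap B)\to\eta(A)\eta(B)$ for all Borel sets $A,B$. $\Lambda$ is Lebesgue measure on $[0,1]$. $\mathrm{var}(f)$ is the infimum over $g=f$ a.e. of the total variation of $g$ on $[0,1]$; $\mathrm{BV}$ is the space of real integrable $f$ with $\mathrm{var}(f)<\infty$, normed by $\max\{\|f\|_1,\mathrm{var}(f)\}$. With $\Omega_0=\bigcup_{I\in\mathscr I}\mathrm{int}(I)$, $\phi(x)=1/|T'(x)|$ for $x\in\Omega_0$ and $\phi(x)=\liminf_{y\to x,\,y\in\Omega_0}\phi(y)$ otherwise, the Perron–Frobenius operator is $P(s)(x)=\sum_{I\in\mathscr{I}}\phi(T|_I^{-1}x)\,s(T|_I^{-1}x)\,\mathbf 1_{T(I)}(x)$ on $\mathrm{BV}$. Spectral decomposition hypothesis: there are a non-negative $h\in\mathrm{BV}$ with $\int h\,d\Lambda=1$, $P h=h$, and $\eta=h\,\Lambda$, and bounded operators $\Phi,\Psi$ on $\mathrm{BV}$ with $\Phi(s)=\big(\int s\,d\Lambda\big)h$, $P=\Phi+\Psi$, $\Phi\Psi=\Psi\Phi=0$, and constants $M>0$, $q\in(0,1)$ with $\|\Psi^n\|_{\mathrm{op}}\le Mq^n$ for all $n$. For a measure $\mu$ on $\mathbb{Z}$, $\widetilde{\mu}(A)=\overline{\mu(-A)}$,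 $\mu|_n$ is the restriction to $\{|x|\le n\}$, and the autocorrelation $\gamma_\mu$ is the vague limit (pointwise convergence of masses at each $z\in\mathbb{Z}$) of $\frac1{2n+1}\mu|_n*\widetilde{\mu|_n}$. $\mathbb{T}$ is the unit circle in $\mathbb{C}$ (dual group of $\mathbb{Z}$ via $(x,z)=x^z$), $\omega_{\mathbb{T}}$ its normalised Haar (Lebesgue) measure, and $\delta_1$ the unit point mass at $1\in\mathbb{T}$. The diffraction $\widehat{\gamma}$ of a positive definite translation bounded measure $\gamma$ on $\mathbb{Z}$ is the unique measure on $\mathbb{T}$ with $\int\widehat{\varphi}\,d\gamma=\int\varphi\,d\widehat{\gamma}$ for all $\varphi=l*\widetilde{l}$, $l\in C(\mathbb{T})$, where $\widehat{\varphi}(z)=\int_{\mathbb{T}}\varphi(x)\overline{x^z}\,d\omega_{\mathbb{T}}(x)$ and $\widetilde{l}(x)=\overline{l(x^{-1})}$. *)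

(* Defs.v *)
(* mathcomp-analysis over an abstract R : realType,
   complex numbers R[i] from mathcomp-real-closed. *)
From HB Require Import structures.
From mathcomp Require Import all_boot all_order all_algebra.
From mathcomp Require Import all_classical all_reals all_analysis.
From mathcomp Require Import complex.

Set Implicit Arguments.
Unset Strict Implicit.
Unset Printing Implicit Defensive.

Import Order.TTheory GRing.Theory Num.Theory.
Import numFieldNormedType.Exports.

Local Open Scope classical_set_scope.
Local Open Scope ring_scope.

Section Defs.
Variable R : realType.

Local Notation leb := (@lebesgue_measure R).
Definition I01 : set R := `[0%R, 1%R]%classic.

(* Piecewise monotonic maps                                           *)

(* [T] maps [0,1] into [0,1] *)
Definition maps_unit_interval (T : R -> R) : Prop :=
  forall x, I01 x -> I01 (T x).

(* one-sided (within [I]) differentiability of T at x *)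
Definition derivable_within (A : set R) (T : R -> R) (x : R) : Prop :=
  exists l : R,
    (fun y => (T y - T x) / (y - x)) @ within (A `\ x) (nbhs x) --> l.

(* [parts] is a finite partition of [0,1] into intervals such that on
   each part T is continuous, strictly monotone and differentiable. *)
Definition piecewise_monotonic (T : R -> R) (parts : seq (interval R)) : Prop :=
  [/\ (forall x, I01 x <-> exists2 I, I \in parts & x \in I),
      (forall I J, I \in parts -> J \in parts -> I != J ->
          [set` I] `&` [set` J] = set0)
    & (forall I, I \in parts ->
        [/\ {within [set` I], continuous T},
            ((forall x y, x \in I -> y \in I -> x < y -> T x < T y) \/
             (forall x y, x \in I -> y \in I -> x < y -> T y < T x))
          & (forall x, x \in I -> derivable_within [set` I] T x)])].

(* Omega_0 : union of the interiors of the parts *)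
Definition Omega0 (parts : seq (interval R)) : set R :=
  \bigcup_(I in [set I | I \in parts]) interior [set` I].

(* 1/|T'(x)|, with value +oo when T'(x) = 0 *)
Definition phi0 (T : R -> R) (x : R) : \bar R :=
  if derive1 T x == 0 then +oo%E else ((`|derive1 T x|)^-1)%:E.

(* phi = 1/|T'| on Omega_0, and the liminf over Omega_0 elsewhere.
   (The extended-real value +oo, which only occurs on a set whose image
   under T is Lebesgue-null, is sent to 0 by [fine].) *)
Definition phi (T : R -> R) (parts : seq (interval R)) (x : R) : R :=
  if x \in Omega0 parts then fine (phi0 T x)
  else fine (ereal_sup
         [set ereal_inf (phi0 T @` [set y | Omega0 parts y /\ 0 < `|y - x| < e])
          | e in `]0%R, +oo[]).

(* the inverse branch T|_I^{-1} x (meaningful when x \in T(I)) *)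
Definition inv_branch (T : R -> R) (I : interval R) (x : R) : R :=
  get [set y | y \in I /\ T y = x].

(* Perron-Frobenius operator *)
Definition PF (T : R -> R) (parts : seq (interval R)) (s : R -> R) (x : R) : R :=
  \sum_(I <- parts)
     phi T parts (inv_branch T I x) * s (inv_branch T I x)
       * \1_(T @` [set` I]) x.

(* Bounded variation                                                  *)

(* equality Lebesgue-a.e. on [0,1] *)
Definition aeq01 (f g : R -> R) : Prop := f = g %[ae leb in I01].

Definition var01 (f : R -> R) : \bar R :=
  ereal_inf [set total_variation 0 1 g | g in [set g | aeq01 g f]].

Definition BV (f : R -> R) : Prop :=
  leb.-integrable I01 (EFin \o f) /\ (var01 f < +oo)%E.

Definition bvnorm (f : R -> R) : \bar R :=
  maxe (\int[leb]_(x in I01) (`|f x|)%:E)%E (var01 f).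

(* Spectral decomposition hypothesis                                  *)

Definition Phi (h : R -> R) (s : R -> R) : R -> R :=
  fun x => (\int[leb]_(y in I01) s y) * h x.

Definition spectral_decomposition (T : R -> R) (parts : seq (interval R))
    (h : R -> R) (Psi : (R -> R) -> (R -> R)) (M q : R) : Prop :=
  [/\ [/\ BV h, (forall x, I01 x -> 0 <= h x),
          \int[leb]_(x in I01) h x = 1 & aeq01 (PF T parts h) h],
      (* Psi is a (well defined, linear) operator on BV *)
      [/\ (forall s, BV s -> BV (Psi s)),
          (forall s t, BV s -> BV t -> aeq01 s t -> aeq01 (Psi s) (Psi t)),
          (forall s t, BV s -> BV t -> aeq01 (Psi (s \+ t)) (Psi s \+ Psi t))
        & (forall (a : R) s, BV s -> aeq01 (Psi (fun x => a * s x))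
                                          (fun x => a * Psi s x))],
      (* P = Phi + Psi, Phi Psi = Psi Phi = 0 *)
      [/\ (forall s, BV s -> aeq01 (PF T parts s) (Phi h s \+ Psi s)),
          (forall s, BV s -> aeq01 (Phi h (Psi s)) (fun=> 0))
        & (forall s, BV s -> aeq01 (Psi (Phi h s)) (fun=> 0))]
    & [/\ 0 < M, 0 < q < 1 &
          forall (n : nat) s, BV s ->
            (bvnorm (iter n Psi s) <= (M * q ^+ n)%:E * bvnorm s)%E]].

(* the measure eta = h Lambda (restricted to [0,1]) *)
Definition eta_h (h : R -> R) (A : set R) : \bar R :=
  (\int[leb]_(x in A `&` I01) (h x)%:E)%E.

Definition T_invariant (T : R -> R) (h : R -> R) : Prop :=
  forall A : set R, measurable A -> eta_h h (T @^-1` A) = eta_h h A.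

Definition mixing (T : R -> R) (h : R -> R) : Prop :=
  forall A B : set R, measurable A -> measurable B ->
    (eta_h h ((iter n T) @^-1` A `&` B) @[n --> \oo] --> (eta_h h A * eta_h h B)%E).

(* integral w.r.t. eta *)
Definition int_eta (h f : R -> R) : R := \int[leb]_(x in I01) (f x * h x).

(* Return time measures and autocorrelation                          *)

(* weights of mu_y = sum_{n >= 0} f (T^n y) delta_n *)
Definition return_weights (T f : R -> R) (y : R) (k : int) : R :=
  if (0 <= k)%R then f (iter `|k|%N T y) else 0.

(* restriction mu|_n *)
Definition restr (n : nat) (w : int -> R) (k : int) : R :=
  if (`|k| <= n)%N then w k else 0.

(* mass at z of (2n+1)^{-1} mu|_n * (mu|_n)~ , for a real measure mu
   (for real weights, complex conjugation is the identity) *)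
Definition autocorr_approx (w : int -> R) (n : nat) (z : int) : R :=
  (n.*2.+1)%:R^-1 *
  \sum_(i < n.*2.+1)
     restr n w (i%:Z - n%:Z) * restr n w (i%:Z - n%:Z - z).

Definition coef_c (Psi : (R -> R) -> (R -> R)) (h f : R -> R) (z : int) : R :=
  if z == 0 then int_eta h (fun x => f x ^+ 2) - (int_eta h f) ^+ 2
  else \int[leb]_(x in I01) (iter `|z|%N Psi (fun t => f t * h t) x * f x).

(* The circle group, Haar measure, Fourier transform                  *)

Local Open Scope complex_scope.

Definition on_circle (x : R[i]) : Prop := `|x| = 1.

Definition circ (t : R) : R[i] := (cos (2 * pi * t)) +i* (sin (2 * pi * t)).

(* integral of G : T -> C against normalised Haar measure omega_T *)
Definition haar_int (G : R[i] -> R[i]) : R[i] :=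
  (\int[leb]_(t in I01) complex.Re (G (circ t))) +i*
  (\int[leb]_(t in I01) complex.Im (G (circ t))).

(* l \in C(T) *)
Definition continuous_on_circle (l : R[i] -> R[i]) : Prop :=
  continuous (fun t => complex.Re (l (circ t))) /\
  continuous (fun t => complex.Im (l (circ t))).

(* l * ~l *)
Definition conv_tilde (l : R[i] -> R[i]) (x : R[i]) : R[i] :=
  haar_int (fun y => l y * (l (x^-1 * y))^*).

(* Fourier coefficient hat(phi)(z) *)
Definition fourier (ph : R[i] -> R[i]) (z : int) : R[i] :=
  haar_int (fun x => ph x * (x ^ z)^*).

(* symmetric partial sums over {|z| <= N} *)
Definition zpsum (u : int -> R[i]) (N : nat) : R[i] :=
  \sum_(i < N.*2.+1) u (i%:Z - N%:Z).

(* sum_{z in Z} u z is absolutely convergent with value L *)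
Definition zsum_to (u : int -> R[i]) (L : R[i]) : Prop :=
  [/\ exists C : R, forall N, zpsum (fun z => (`|u z|)) N <= C%:C,
      (fun N => complex.Re (zpsum u N)) @ \oo --> complex.Re L
    & (fun N => complex.Im (zpsum u N)) @ \oo --> complex.Im L].

End Defs.

(* Main.v *)
Require Import Defs.
From HB Require Import structures.
From mathcomp Require Import all_boot all_order all_algebra.
From mathcomp Require Import all_classical all_reals all_analysis.
From mathcomp Require Import measurable_realfun complex.
From mathcomp Require Import zify ring lra.
Set Implicit Arguments.
Unset Strict Implicit.
Unset Printing Implicit Defensive.
Import Order.TTheory GRing.Theory Num.Theory.
Import numFieldNormedType.Exports.
Local Open Scope classical_set_scope.
Local Open Scope ring_scope.
Local Open Scope complex_scope.

(** Since [Phi Psi = 0], the transfer operator preserves the integral of every function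
of bounded variation. As [P (s * (g o T)) = P s * g] holds pointwise, this alone yields
the duality [int s * (g o T) = int P s * g] for [s] and [g] of bounded variation, without
any change of variables; nonsingularity of [T], which is needed to make sense of [g o T]
for a class [g], follows from the case where [g] is the indicator of a half-line.

Iterating the duality gives [E (F * G o T^n) = E F * E G + int Psi^n (F h) G], whose last
term decays like [q^n]. Hence the Birkhoff sums [S_n] of a centered [F] have variance
[O(n)], so that [S_(k^2) / k^2 -> 0] almost everywhere, and boundedness of [F] fills the
gaps between consecutive squares. Applied to [F = f * f o T^|z|], this law of large
numbers computes the autocorrelation; the factor 1/2 comes from [mu_y] being supported
on the nonnegative integers.

For the diffraction, [l * ~l] has Fourier coefficients [|l^(z)|^2 >= 0], and Fejer
summation at [1] together with positivity gives [sum_z |l^(z)|^2 = (l * ~l)(1)]. This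
is the contribution of the Dirac mass, and the remaining part is a uniformly convergent
series of continuous functions, which may be integrated term by term. *)

(** * Functions of bounded variation on the unit interval *)

(** Two obstacles shape the proof. First, [BV] is insensitive to null sets, whereas [g \o T] depends
    on every value of [g] until [T] is known to pull null sets back to null sets. The way out is
    [jordan], a pointwise notion stable under composition with piecewise monotone maps: indicators
    of half-lines are monotone everywhere, so the duality already applies to them, and they generate
    the Borel sets. Second, Lebesgue-null and eta-null sets differ where [h] vanishes. The almost
    sure statements are obtained for Lebesgue measure from integrals weighted by [h], hence speak
    only of points with [h x > 0]; the zero set of [h] joins the exceptional set at the end. Squares
    appear because the averages have variance [O(1/n)], which is not summable, while along [n = k^2]
    it is. The diffraction formula is tested on [l * ~l] only. For these functions positivity of the
    Fourier coefficients makes the Fourier series summable, which mere continuity would not. *)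

Section BoundedVariation.
Context {R : realType}.
Implicit Types (f g s t u v w : R -> R) (x y : R).
Local Notation leb := (@lebesgue_measure R).
Local Notation I01 := (@I01 R).

Lemma I01P x : I01 x <-> 0 <= x <= 1.
Proof. by rewrite /Defs.I01 /= in_itv. Qed.

Lemma measurable_I01 : measurable I01.
Proof. exact: measurable_itv. Qed.
Hint Resolve measurable_I01 : core.

Lemma lebesgue_I01 : leb I01 = 1%:E.
Proof. by rewrite /Defs.I01 lebesgue_measure_itv /= lte_fin ltr01 oppr0 adde0. Qed.

(** Non-negativity is included so that products of such functions are again increasing; it costs
    nothing, since an increasing function on [0,1] becomes non-negative after adding a constant. *)
Definition incr01 u := (forall x y, I01 x -> I01 y -> x <= y -> u x <= u y) /\
  (forall x, I01 x -> 0 <= u x).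

(** Bounded variation in the pointwise sense, through the Jordan decomposition. Sums, products and
    compositions with monotone maps are easier to handle here than with suprema over partitions. *)
Definition jordan g := exists u v,
  [/\ incr01 u, incr01 v & forall x, I01 x -> g x = u x - v x].

Lemma eq_jordan f g : (forall x, I01 x -> f x = g x) -> jordan f -> jordan g.
Proof.
move=> fg [u [v [iu iv e]]]; exists u, v; split => // x Ix.
by rewrite -fg// e.
Qed.

Lemma incr01D u v : incr01 u -> incr01 v -> incr01 (fun x => u x + v x).
Proof.
move=> [iu u0] [iv v0]; split => [x y Ix Iy xy|x Ix]; last by rewrite addr_ge0 ?u0 ?v0.
by rewrite lerD ?iu ?iv.
Qed.

Lemma incr01M u v : incr01 u -> incr01 v -> incr01 (fun x => u x * v x).
Proof.
move=> [iu u0] [iv v0]; split => [x y Ix Iy xy|x Ix]; last by rewrite mulr_ge0 ?u0 ?v0.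
by rewrite ler_pM ?iu ?iv ?u0 ?v0.
Qed.

Lemma incr01_cst (c : R) : 0 <= c -> incr01 (fun=> c).
Proof. by move=> c0; split. Qed.

Lemma jordan_incr u : incr01 u -> jordan u.
Proof. by move=> iu; exists u, (fun=> 0); split=> [//||x _]; [exact: incr01_cst|rewrite subr0]. Qed.

Lemma jordanN f : jordan f -> jordan (fun x => - f x).
Proof. by move=> [u [v [iu iv e]]]; exists v, u; split => // x Ix; rewrite e// opprB. Qed.

Lemma jordan_cst (c : R) : jordan (fun=> c).
Proof.
have [c0|c0] := leP 0 c; first by apply: jordan_incr; exact: incr01_cst.
rewrite -(opprK c); apply: jordanN; apply: jordan_incr; apply: incr01_cst.
by rewrite oppr_ge0 ltW.
Qed.

Lemma jordanD f g : jordan f -> jordan g -> jordan (fun x => f x + g x).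
Proof.
move=> [u [v [iu iv e]]] [u' [v' [iu' iv' e']]].
exists (fun x => u x + u' x), (fun x => v x + v' x); split.
- exact: incr01D.
- exact: incr01D.
- by move=> x Ix; rewrite e// e'//; ring.
Qed.

Lemma jordanM f g : jordan f -> jordan g -> jordan (fun x => f x * g x).
Proof.
move=> [u [v [iu iv e]]] [u' [v' [iu' iv' e']]].
exists (fun x => u x * u' x + v x * v' x), (fun x => u x * v' x + v x * u' x); split.
- by apply: incr01D; apply: incr01M.
- by apply: incr01D; apply: incr01M.
- by move=> x Ix; rewrite e// e'//; ring.
Qed.

Lemma jordan_bounded f : jordan f -> exists2 K, 0 <= K & forall x, I01 x -> `|f x| <= K.
Proof.
move=> [u [v [[iu u0] [iv v0] e]]].
have I1 : I01 1 by rewrite I01P ler01 lexx.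
exists (u 1 + v 1); first by rewrite addr_ge0 ?u0 ?v0.
move=> x Ix; rewrite e// (le_trans (ler_normB _ _))// lerD// ger0_norm ?u0 ?v0//.
  by apply: iu => //; move: Ix; rewrite I01P => /andP[].
by apply: iv => //; move: Ix; rewrite I01P => /andP[].
Qed.

Lemma eq_total_variation f g : (forall x, I01 x -> f x = g x) ->
  total_variation 0 1 f = total_variation 0 1 g.
Proof.
move=> fg; rewrite /total_variation; congr (ereal_sup [set _ | _ in _]).
have H (f' g' : R -> R) : (forall x, I01 x -> f' x = g' x) ->
    variations 0 1 f' `<=` variations 0 1 g'.
  move=> fg' r [s st <-]; exists s => //.
  rewrite /variation; apply: eq_big_nat => i /andP[_ ilt].
  have I0 : I01 0 by rewrite I01P ler01 lexx.
  (* A partition is a strictly increasing list that starts after 0 and whose last element is 1, so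
     its points lie in [0,1]. *)
  have Is x : x \in s -> I01 x.
    move=> xs; case: st => ps ls; rewrite I01P.
    have : all (fun y => 0 <= y) s.
      apply: sub_all (order_path_min lt_trans ps) => y; exact: ltW.
    move=> /allP /(_ _ xs) -> /=.
    rewrite -(eqP ls); move: ps xs; clear; elim: s 0 => // a s IH b /= /andP[ba pa].
    rewrite inE => /predU1P[->|]; last exact: IH.
    have := order_path_min lt_trans pa; case: s IH pa => // c s _ pa /allP H.
    by apply/ltW/H; rewrite /= mem_last.
  have In j : (j <= size s)%N -> I01 (nth 1 (0 :: s) j).
    by case: j => [//|j] js /=; apply: Is; rewrite mem_nth.
  have h1 := In i (ltnW ilt); have h2 := In i.+1 ilt.
  by rewrite /comp !fg'.
by apply/seteqP; split; apply: H => // x Ix; rewrite fg.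
Qed.

Lemma jordan_tvP f : jordan f <-> (total_variation 0 1 f < +oo)%E.
Proof.
split.
  move=> [u [v [[iu u0] [iv v0] e]]].
  rewrite (eq_total_variation e).
  have [BVu BVv] : bounded_variation 0 1 u /\ bounded_variation 0 1 v.
    by split; apply: nondecreasing_bounded_variation => x y Ix Iy xy;
      [apply: iu|apply: iv].
  have /(bounded_variationP _ ler01) : bounded_variation 0 1 (u \+ (\- v)).
    by apply: bounded_variationD => //; exact: bounded_variationN.
  by rewrite ge0_fin_numE// total_variation_ge0// ler01.
move=> tv; have BV : bounded_variation 0 1 f.
  by apply/(bounded_variationP _ ler01); rewrite ge0_fin_numE// total_variation_ge0// ler01.
have I0 : I01 0 by rewrite I01P ler01 lexx.
(* Adding the same [c] to both monotone parts makes them non-negative, from their value at 0 on, and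
   leaves their difference unchanged. *)
pose c := `|(fine \o pos_tv 0 f) 0| + `|(fine \o neg_tv 0 f) 0|.
have nd w : {in `[0, 1] &, nondecreasing_fun w} -> `|w 0| <= c -> incr01 (fun x => w x + c).
  move=> iw wc.
  have iw' x y : I01 x -> I01 y -> x <= y -> w x <= w y by move=> Ix Iy; apply: iw.
  split => [x y Ix Iy xy|x Ix]; first by rewrite lerD2r iw'.
  have : w 0 <= w x by apply: iw' => //; move: Ix; rewrite I01P => /andP[].
  by move: wc; rewrite ler_norml => /andP[? ?]; lra.
exists (fun x => (fine \o pos_tv 0 f) x + c), (fun x => (fine \o neg_tv 0 f) x + c); split.
- apply: nd; last by rewrite lerDl.
  apply: fine_neg_tv_nondecreasing; exact: bounded_variationN.
- apply: nd; last by rewrite lerDr.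
  exact: fine_neg_tv_nondecreasing.
- move=> x Ix; rewrite (bounded_variation_pos_neg_tvE BV)//=.
  by rewrite opprD addrACA subrr addr0.
Qed.

#[global] Instance ae_leb_filter : Filter (nbhs (almost_everywhere leb)) :=
  ae_filter_ringOfSetsType leb.

Lemma aeq01_trans f g s : aeq01 f g -> aeq01 g s -> aeq01 f s.
Proof. by move=> fg gs; apply: filterS2 fg gs => x h1 h2 Ix; rewrite h1// h2. Qed.

Lemma aeq01_sym f g : aeq01 f g -> aeq01 g f.
Proof. by apply: filterS => x h Ix; rewrite h. Qed.

Lemma aeq01W f g : (forall x, I01 x -> f x = g x) -> aeq01 f g.
Proof. by move=> fg; apply: aeW => x; exact: fg. Qed.

Lemma aeq01D f f' g g' : aeq01 f f' -> aeq01 g g' ->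
  aeq01 (fun x => f x + g x) (fun x => f' x + g' x).
Proof. by move=> ff' gg'; apply: filterS2 ff' gg' => x h1 h2 Ix; rewrite h1// h2. Qed.

Lemma aeq01M f f' g g' : aeq01 f f' -> aeq01 g g' ->
  aeq01 (fun x => f x * g x) (fun x => f' x * g' x).
Proof. by move=> ff' gg'; apply: filterS2 ff' gg' => x h1 h2 Ix; rewrite h1// h2. Qed.

Lemma aeq01_int f g : measurable_fun I01 f -> measurable_fun I01 g -> aeq01 f g ->
  \int[leb]_(x in I01) f x = \int[leb]_(x in I01) g x.
Proof.
move=> mf mg fg; congr fine; apply: ae_eq_integral => //.
- exact/measurable_EFinP.
- exact/measurable_EFinP.
- by apply: filterS fg => x h Ix; rewrite h.
Qed.

(** If the infimum [var01] is finite, some representative has finite total variation; conversely a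
    [jordan] representative is bounded, which gives integrability. Measurability of [f] itself has
    to be kept, since a.e. equality does not transfer Borel measurability. *)
Lemma BVP f : BV f <-> measurable_fun I01 f /\ exists2 g, jordan g & aeq01 f g.
Proof.
split => [[intf vf]|[mf [g jg fg]]].
  split; first by case/integrableP : intf => /measurable_EFinP.
  move: vf; rewrite /var01 => /ereal_inf_lt[_ [g gf <-]] tvg.
  by exists g; [exact/jordan_tvP|exact: aeq01_sym].
have [K K0 Kg] := jordan_bounded jg.
split; last first.
  apply: le_lt_trans ((jordan_tvP g).1 jg); apply: ereal_inf_lbound.
  by exists g => //; exact: aeq01_sym.
apply/integrableP; split; first exact/measurable_EFinP.
apply: (@le_lt_trans _ _ (\int[leb]_(x in I01) K%:E)%E); last first.
  by rewrite integral_cst// [X in (_ * X)%E](lebesgue_I01) mule1 ltry.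
apply: ae_ge0_le_integral => //.
- by do 2 apply: measurableT_comp => //.
- by apply: filterS fg => x h Ix; rewrite /= lee_fin h// Kg.
Qed.

Lemma BV_integrable f : BV f -> leb.-integrable I01 (EFin \o f).
Proof. by case. Qed.

Lemma BV_measurable f : BV f -> measurable_fun I01 f.
Proof. by move/BVP => []. Qed.

Lemma BV_cst (c : R) : BV (fun=> c).
Proof.
by apply/BVP; split=> //; exists (fun=> c); [exact: jordan_cst|exact: aeq01W].
Qed.

Lemma BVD f g : BV f -> BV g -> BV (fun x => f x + g x).
Proof.
move=> /BVP[mf [f' jf ff']] /BVP[mg [g' jg gg']]; apply/BVP; split.
  exact: measurable_funD.
exists (fun x => f' x + g' x); first exact: jordanD.
exact: aeq01D.
Qed.

Lemma BVM f g : BV f -> BV g -> BV (fun x => f x * g x).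
Proof.
move=> /BVP[mf [f' jf ff']] /BVP[mg [g' jg gg']]; apply/BVP; split.
  exact: measurable_funM.
exists (fun x => f' x * g' x); first exact: jordanM.
exact: aeq01M.
Qed.

Lemma BVN f : BV f -> BV (fun x => - f x).
Proof.
by move=> bf; under eq_fun do rewrite -mulN1r; apply: BVM => //; exact: BV_cst.
Qed.

Lemma BVB f g : BV f -> BV g -> BV (fun x => f x - g x).
Proof. by move=> bf bg; apply: BVD => //; exact: BVN. Qed.

Lemma BV_sum (F : nat -> R -> R) n : (forall k, BV (F k)) -> BV (fun x => \sum_(k < n) F k x).
Proof.
move=> BF; elim: n => [|n IH]; first by under eq_fun do rewrite big_ord0; exact: BV_cst.
by under eq_fun do rewrite big_ord_recr/=; exact: BVD.
Qed.

Lemma intD f g : BV f -> BV g -> \int[leb]_(x in I01) (f x + g x) =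
  \int[leb]_(x in I01) f x + \int[leb]_(x in I01) g x.
Proof. by move=> bf bg; rewrite RintegralD//; apply: BV_integrable. Qed.

Lemma intZ (c : R) f : BV f -> \int[leb]_(x in I01) (c * f x) =
  c * \int[leb]_(x in I01) f x.
Proof. by move=> bf; rewrite RintegralZl//; apply: BV_integrable. Qed.

Lemma EFin_int f : BV f ->
  (\int[leb]_(x in I01) f x)%:E = (\int[leb]_(x in I01) (f x)%:E)%E.
Proof.
move=> Bf; rewrite /Rintegral fineK//.
by apply: integrable_fin_num => //; exact: BV_integrable.
Qed.

End BoundedVariation.

(** * Piecewise monotonic maps and the Perron-Frobenius operator *)

Section PiecewiseMonotonic.
Context {R : realType}.
Implicit Types (f g s t u v w : R -> R) (x y : R) (I : interval R).
Local Notation leb := (@lebesgue_measure R).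
Local Notation I01 := (@I01 R).

(* [step_ext I w K] is [w] on [I], and the constant [K] (resp. [0]) to the right
   (resp. left) of [I]: it is increasing when [w] is increasing on [I] with values
   in [0, K]. *)
Definition step_ext I w (K : R) x : R :=
  if x \in I then w x else if `[< exists2 y, y \in I & I01 y /\ y < x >] then K else 0.

Lemma step_ext_incr I w K : 0 <= K ->
  (forall x y, I01 x -> I01 y -> x \in I -> y \in I -> x <= y -> w x <= w y) ->
  (forall x, I01 x -> x \in I -> 0 <= w x <= K) -> incr01 (step_ext I w K).
Proof.
move=> K0 iw wK; split => [x y Ix Iy xy|x Ix]; last first.
  rewrite /step_ext; case: ifPn => [xI|_]; first by have /andP[] := wK x Ix xI.
  by case: ifPn.
have [->//|xney] := eqVneq x y; have ltxy : x < y by rewrite lt_neqAle xney.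
rewrite /step_ext; case: (boolP (x \in I)) => xI.
  case: ifPn => [yI|yI]; first exact: iw.
  case: ifPn => [_|/asboolP h]; first by have /andP[] := wK x Ix xI.
  by exfalso; apply: h; exists x.
case: (asboolP (exists2 z, z \in I & I01 z /\ z < x)) => [[z zI [Iz zx]]|_]; last first.
  by case: ifPn => [yI|_]; [have /andP[] := wK y Iy yI|case: ifPn].
case: ifPn => [yI|yI]; last first.
  rewrite ifT//; apply/asboolP; exists z => //; split=> //.
  exact: lt_le_trans xy.
exfalso; move/negP: xI; apply.
have := @interval_is_interval _ I z y zI yI x.
by apply; rewrite (ltW zx).
Qed.

(** The step extensions of the constants 1 and 0 coincide off [I], so their difference is the
    indicator. *)
Lemma jordan_indic_itv I : jordan (fun x => (x \in I)%:R : R).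
Proof.
have h1 : jordan (step_ext I (fun=> 1) 1).
  by apply: jordan_incr; apply: step_ext_incr => // x _ _; rewrite ler01 lexx.
have h2 : jordan (step_ext I (fun=> 0) 1).
  by apply: jordan_incr; apply: step_ext_incr => // x _ _; rewrite ler01 lexx.
apply: (eq_jordan _ (jordanD h1 (jordanN h2))) => x Ix; rewrite /step_ext.
by case: ifPn => xI; [rewrite subr0|rewrite subrr].
Qed.

(** A decreasing [w] is turned into the increasing [|K| - w]. The absolute value matters only when
    [I] misses [0,1], where nothing forces [K] to be non-negative. *)
Lemma jordan_monotone_on I w (K : R) :
  ((forall x y, I01 x -> I01 y -> x \in I -> y \in I -> x <= y -> w x <= w y) \/
   (forall x y, I01 x -> I01 y -> x \in I -> y \in I -> x <= y -> w y <= w x)) ->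
  (forall x, I01 x -> x \in I -> 0 <= w x <= K) ->
  exists2 g, jordan g & forall x, I01 x -> x \in I -> g x = w x.
Proof.
move=> mw wK.
have wK' x : I01 x -> x \in I -> 0 <= w x <= `|K|.
  by move=> Ix xI; have /andP[-> /le_trans] := wK x Ix xI; apply; exact: ler_norm.
case: mw => mw.
  exists (step_ext I w `|K|).
    by apply: jordan_incr; apply: step_ext_incr.
  by move=> x Ix xI; rewrite /step_ext xI.
exists (fun x => `|K| + - step_ext I (fun x => `|K| - w x) `|K| x).
  apply: jordanD; first exact: jordan_cst.
  apply: jordanN; apply: jordan_incr; apply: step_ext_incr => // [x y *|x Ix xI].
    by rewrite lerD2l lerN2 mw.
  by have /andP[? ?] := wK' x Ix xI; rewrite subr_ge0 gerBl; apply/andP.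
by move=> x Ix xI; rewrite /step_ext xI opprB addrC subrK.
Qed.

Variables (T : R -> R) (parts : seq (interval R)).
Hypothesis Tmaps : maps_unit_interval T.
Hypothesis Tpm : piecewise_monotonic T parts.

(** On each part, [u \o T] and [v \o T] are monotone with values in [[0, u 1]] and [[0, v 1]]. The
    pieces are glued one part at a time by indicators of intervals, and [jordan] is stable under the
    sums and products involved. *)
Lemma jordan_comp g : jordan g -> jordan (g \o T).
Proof.
move=> [u [v [[iu u0] [iv v0] e]]].
case: Tpm => partsP _ Tmono.
have piece w I : I \in parts -> incr01 w ->
    exists2 g', jordan g' & forall x, I01 x -> x \in I -> g' x = w (T x).
  move=> Ip [iw w0]; apply: (@jordan_monotone_on _ _ (w 1)).
    have [_ mon _] := Tmono I Ip.
    case: mon => mon; [left|right] => x y Ix Iy xI yI;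
      rewrite le_eqVlt => /predU1P[->//|xy]; apply: iw; do ?exact: Tmaps;
      exact/ltW/mon.
  move=> x Ix xI; have ITx := Tmaps Ix; rewrite w0//= iw//.
    by rewrite I01P ler01 lexx.
  by move/I01P : ITx => /andP[].
suff [G jG eG] : exists2 G, jordan G & forall x, I01 x ->
    (exists2 I, I \in parts & x \in I) -> G x = g (T x).
  by apply: eq_jordan jG => x Ix; apply: eG => //; exact/partsP.
have : {subset parts <= parts} by [].
elim: {1 3}parts => [_|I s IH sub].
  by exists (fun=> 0); [exact: jordan_cst|move=> x _ [I]; rewrite in_nil].
have Ip : I \in parts by apply: sub; rewrite mem_head.
have [|G jG eG] := IH; first by move=> J Js; apply: sub; rewrite inE Js orbT.
have [gu ju eu] := piece u I Ip (conj iu u0).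
have [gv jv ev] := piece v I Ip (conj iv v0).
have j1 := jordan_indic_itv I.
exists (fun x => (x \in I)%:R * (gu x + - gv x) + (1 + - (x \in I)%:R) * G x).
  apply: jordanD; apply: jordanM => //; apply: jordanD => //.
  - exact: jordanN.
  - exact: jordan_cst.
  - exact: jordanN.
move=> x Ix [J]; rewrite inE; case: (boolP (x \in I)) => xI.
  move=> _ _; rewrite mul1r subrr mul0r addr0 eu// ev// e//.
  exact: Tmaps.
move=> /predU1P[->|Js] xJ; first by rewrite xJ in xI.
by rewrite mul0r add0r subr0 mul1r eG//; exists J.
Qed.

Lemma measurable_T : measurable_fun I01 T.
Proof.
case: Tpm => partsP _ Tmono.
have -> : I01 = \big[setU/set0]_(I <- parts) [set` I].
  apply/seteqP; split => x.
    move=> /partsP[I Ip xI]; rewrite -bigcup_seq; exists I => //.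
  by rewrite -bigcup_seq => -[I Ip xI]; apply/partsP; exists I.
have : {subset parts <= parts} by [].
elim: {1 3}parts => [_|I s IH sub]; first by rewrite big_nil; exact: measurable_fun_set0.
rewrite big_cons; apply/measurable_funU.
- exact: measurable_itv.
- by rewrite -bigcup_seq; apply: fin_bigcup_measurable.
split; last by apply: IH => J Js; apply: sub; rewrite inE Js orbT.
have [cT _ _] := Tmono I (sub I (mem_head _ _)).
by apply: subspace_continuous_measurable_fun cT; exact: measurable_itv.
Qed.

Lemma measurable_compT g : measurable_fun I01 g -> measurable_fun I01 (g \o T).
Proof.
move=> mg; apply: (measurable_comp (F := I01)) => //.
- exact: measurable_I01.
- by move=> _ [x Ix <-]; exact: Tmaps.
- exact: measurable_T.
Qed.

Lemma maps_iter n x : I01 x -> I01 (iter n T x).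
Proof. by move=> Ix; elim: n => //= n; exact: Tmaps. Qed.

Lemma inv_branchP I x : (T @` [set` I]) x ->
  inv_branch T I x \in I /\ T (inv_branch T I x) = x.
Proof.
move=> [y /= yI <-].
have : [set z | z \in I /\ T z = T y] !=set0 by exists y.
by move=> /getPex.
Qed.

(* The Perron-Frobenius operator pulls factors of the form [g \o T] out, which is
   why it only takes [int (PF s) = int s] to obtain the full duality relation. *)
Lemma PF_comp s g x : PF T parts (fun y => s y * g (T y)) x = PF T parts s x * g x.
Proof.
rewrite /PF big_distrl /=; apply: eq_bigr => I _.
rewrite indicE; case: (boolP (x \in _)) => [|_]; last by rewrite !mulr0 mul0r.
by rewrite inE => /inv_branchP[_ ->]; rewrite !mulr1 mulrA.
Qed.

Lemma phi0_ge0 x : (0 <= phi0 T x)%E.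
Proof. by rewrite /phi0; case: ifP => // _; rewrite lee_fin invr_ge0. Qed.

Lemma phi_ge0 x : 0 <= phi T parts x.
Proof.
rewrite /phi; case: ifP => _; apply: fine_ge0; first exact: phi0_ge0.
set A := [set _ | _ in _].
have [a [Aa a0]] : exists a, A a /\ (0 <= a)%E.
  eexists; split; first by exists 1 => //=; rewrite in_itv/= ltr01.
  by apply: le_ereal_inf_tmp => _ [y _ <-]; exact: phi0_ge0.
by apply: (le_trans a0); exact: ereal_sup_ubound.
Qed.

Lemma PF_ge0 s x : (forall y, I01 y -> 0 <= s y) -> 0 <= PF T parts s x.
Proof.
move=> s0; rewrite /PF big_seq; apply: sumr_ge0 => I Ip.
rewrite indicE; case: (boolP (x \in _)) => [|_]; last by rewrite mulr0.
rewrite inE => /inv_branchP[xI _]; rewrite mulr1 mulr_ge0 ?phi_ge0// s0//.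
by case: Tpm => partsP _ _; apply/partsP; exists I.
Qed.

End PiecewiseMonotonic.

(** * Duality and nonsingularity *)

(** The absolute value makes this a measure for every measurable [q]. It is applied to the image of
    the constant 1 under the transfer operator, which is non-negative a.e. *)
Definition density01 {R : realType} (q : R -> R) (A : set (measurableTypeR R)) : \bar R :=
  (\int[@lebesgue_measure R]_(x in A `&` @I01 R) `|q x|%:E)%E.

Section Density.
Context {R : realType}.
Variable q : R -> R.
Hypothesis mq : measurable_fun (@I01 R) q.

Let density0 : density01 q set0 = 0%E.
Proof. by rewrite /density01 set0I integral_set0. Qed.

Let density_ge0 A : (0 <= density01 q A)%E.
Proof. by apply: integral_ge0 => x _; rewrite lee_fin. Qed.

Let density_sigma_additive : semi_sigma_additive (density01 q).
Proof.
move=> F mF tF mUF; rewrite /density01 setI_bigcupl ge0_integral_bigcup//=.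
- by apply: is_cvg_nneseries => n _ _; apply: integral_ge0 => x _; rewrite lee_fin.
- by move=> k; apply: measurableI => //; exact: measurable_I01.
- apply/measurable_EFinP; apply: measurableT_comp => //.
  apply: measurable_funS mq; first exact: measurable_I01.
  by move=> x [k _ []].
- exact: trivIset_setIr.
Qed.

HB.instance Definition _ := isMeasure.Build _ _ _
  (density01 q) density0 density_ge0 density_sigma_additive.

Definition density_measure : {measure set (measurableTypeR R) -> \bar R} := density01 q.
End Density.

(** * Transfer operator: duality, nonsingularity of [T], iterated duality *)

Section Spectral.
Context {R : realType}.
Implicit Types (f g s t u v w : R -> R) (x y : R) (I : interval R).
Local Notation leb := (@lebesgue_measure R).
Local Notation I01 := (@I01 R).
Local Notation "'intI' f" := (\int[leb]_(x in I01) f x) (at level 10, f at level 8).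
Variables (T : R -> R) (parts : seq (interval R)) (h : R -> R).
Variables (Psi : (R -> R) -> R -> R) (M q : R).
Hypothesis Tmaps : maps_unit_interval T.
Hypothesis Tpm : piecewise_monotonic T parts.
Hypothesis SD : spectral_decomposition T parts h Psi M q.

Let BVh : BV h. Proof. by case: SD => -[]. Qed.
Let int_h : intI h = 1. Proof. by case: SD => -[]. Qed.

Lemma BV_Psi s : BV s -> BV (Psi s).
Proof. by case: SD => _ [H _ _ _] _ _; exact: H. Qed.

Lemma BV_iter_Psi n s : BV s -> BV (iter n Psi s).
Proof. by move=> Bs; elim: n => //= n; exact: BV_Psi. Qed.

Lemma aeq01_Psi s t : BV s -> BV t -> aeq01 s t -> aeq01 (Psi s) (Psi t).
Proof. by case: SD => _ [_ H _ _] _ _; exact: H. Qed.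

Lemma aeq01_iter_Psi n s t : BV s -> BV t -> aeq01 s t ->
  aeq01 (iter n Psi s) (iter n Psi t).
Proof.
move=> Bs Bt st; elim: n => //= n; apply: aeq01_Psi; exact: BV_iter_Psi.
Qed.

(** A representative of the Perron-Frobenius operator: it agrees a.e. with [PF T parts s] for [s] in
    [BV], and it is in [BV], measurability included, directly by the properties of [Phi] and
    [Psi]. *)
Definition transfer s : R -> R := fun x => Phi h s x + Psi s x.

Lemma BV_Phi s : BV (Phi h s).
Proof. by apply: BVM => //; exact: BV_cst. Qed.

Lemma BV_transfer s : BV s -> BV (transfer s).
Proof. by move=> Bs; apply: BVD; [exact: BV_Phi|exact: BV_Psi]. Qed.

Lemma PF_transfer s : BV s -> aeq01 (PF T parts s) (transfer s).
Proof. by case: SD => _ _ [H _ _] _; exact: H. Qed.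

Lemma int_Phi s : intI (Phi h s) = intI s.
Proof. by rewrite /Phi intZ// int_h mulr1. Qed.

(* This is the hypothesis [Phi o Psi = 0]. *)
Lemma int_Psi s : BV s -> intI (Psi s) = 0.
Proof.
move=> Bs; case: SD => _ _ [_ H _] _.
have := aeq01_int (BV_measurable (BV_Phi (Psi s))) (BV_measurable (BV_cst 0)) (H s Bs).
by rewrite int_Phi => ->; rewrite Rintegral_cst ?mul0r//; exact: measurable_I01.
Qed.

Lemma int_transfer s : BV s -> intI (transfer s) = intI s.
Proof.
move=> Bs; rewrite /transfer intD; [|exact: BV_Phi|exact: BV_Psi].
by rewrite int_Psi// addr0 int_Phi.
Qed.

(** Integrate [PF_comp] and use [int_transfer]. That the product is in [BV] is a hypothesis because,
    before nonsingularity, it can only be checked for pointwise [jordan] functions [g]. *)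
Lemma duality_of_BV s g : BV s -> measurable_fun I01 g -> BV (fun x => s x * g (T x)) ->
  intI (fun x => s x * g (T x)) = intI (fun x => transfer s x * g x).
Proof.
move=> Bs mg Bsg; rewrite -(int_transfer Bsg).
have e : aeq01 (transfer (fun x => s x * g (T x))) (fun x => transfer s x * g x).
  apply: (aeq01_trans (aeq01_sym (PF_transfer Bsg))).
  have := PF_transfer Bs; apply: filterS => x h1 Ix.
  by rewrite PF_comp h1.
apply: aeq01_int e.
- by apply: BV_measurable; exact: BV_transfer.
- by apply: measurable_funM => //; apply: BV_measurable; exact: BV_transfer.
Qed.

Lemma BV_comp_jordan g : measurable_fun I01 g -> jordan g -> BV (g \o T).
Proof.
move=> mg jg; apply/BVP; split; first exact: (measurable_compT Tmaps Tpm).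
by exists (g \o T); [exact: (jordan_comp Tmaps Tpm)|exact: aeq01W].
Qed.

Lemma transfer1_ge0 : aeq01 (fun x => `|transfer (fun=> 1) x|) (transfer (fun=> 1)).
Proof.
have := PF_transfer (BV_cst 1); apply: filterS => x h1 Ix.
by rewrite -h1// ger0_norm//; apply: (PF_ge0 Tpm).
Qed.

(** Both sides are measures in [A], and the left one is finite. On a half-line [[a, +oo[] they agree
    by the duality with [s = 1] and the indicator of the half-line, and half-lines form a generating
    class stable under intersection. *)
Lemma preimage_density (A : set R) : measurable A ->
  leb (I01 `&` T @^-1` A) = density01 (transfer (fun=> 1)) A.
Proof.
move=> mA; have mI := @measurable_I01 R.
have mTI B : measurable B -> measurable (I01 `&` T @^-1` B).
  by move=> mB; exact: (measurable_T Tpm mI mB).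
(* A pushforward needs a map measurable on the whole line, so [T] is extended by zero; Lebesgue
   measure restricted to [0,1] does not see the extension. *)
have mT : measurable_fun setT (T \_ I01).
  by apply/(measurable_restrictT _ mI); exact: (measurable_T Tpm).
have mT' : measurable_fun [set: measurableTypeR R]
  (T \_ I01 : measurableTypeR R -> measurableTypeR R) by exact: mT.
pose m1 : {measure set (measurableTypeR R) -> \bar R} :=
  measure_function_pushforward__canonical__measure_function_Measure (mrestr leb mI) mT'.
have m1E B : m1 B = leb (I01 `&` T @^-1` B).
  rewrite /m1/= /pushforward /mrestr; congr (leb _).
  apply/seteqP; split=> x /=.
    by move=> [Bx Ix]; split => //; move: Bx; rewrite patchE mem_set.
  by move=> [Ix Bx]; split => //; rewrite patchE mem_set.
rewrite -m1E.
have mt : measurable_fun I01 (transfer (fun=> 1)).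
  by apply: BV_measurable; apply: BV_transfer; exact: BV_cst.
rewrite -[RHS]/(@density_measure R (transfer (fun=> 1)) mt A).
apply: (@measure_unique _ R (measurableTypeR R) (@RGenCInfty.G R)
  (fun k => `[- k%:R, +oo[%classic) _ _ _ _ m1 (density_measure mt) _ _ A mA).
- exact: RGenCInfty.measurableE.
- move=> _ _ [a ->] [b ->]; exists (Num.max a b).
  apply/seteqP; split => z /=; rewrite !in_itv/= !andbT ge_max.
    by move=> [-> ->].
  by move=> /andP[].
- by move=> i; exists (- i%:R).
- apply/seteqP; split => // x _; exists (Num.bound `|x|) => //=.
  rewrite in_itv/= andbT lerNl; apply: ltW.
  apply: (le_lt_trans (ler_norm (- x))); rewrite normrN.
  exact: archi_boundP.
- move=> _ [a ->]; rewrite m1E; set A' := `[a, +oo[%classic.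
  have mA' : measurable A' by exact: measurable_itv.
  have mg : measurable_fun I01 (\1_A' : R -> R) by exact: measurable_indic.
  have jg : jordan (\1_A' : R -> R).
    apply: jordan_incr; split => [x y _ _ xy|x _]; last by rewrite indicE.
    rewrite !indicE; case: (boolP (x \in A')) => xA; last by rewrite ler0n.
    rewrite mem_set//; move: xA; rewrite inE /A'/= !in_itv/= !andbT => ax.
    exact: le_trans xy.
  have BgT := BV_comp_jordan mg jg.
  have Bt := BV_transfer (BV_cst 1).
  have B1gT : BV (fun x => 1 * \1_A' (T x)) by under eq_fun do rewrite mul1r.
  have Btg : BV (fun x => transfer (fun=> 1) x * \1_A' x).
    apply: BVM => //; apply/BVP; split => //; exists (\1_A') => //; exact: aeq01W.
  have dual := @duality_of_BV (fun=> 1) _ (BV_cst 1) mg B1gT.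
  have : (\int[leb]_(x in I01) (1 * \1_A' (T x))%:E =
    \int[leb]_(x in I01) (transfer (fun=> 1) x * \1_A' x)%:E)%E.
    by rewrite -!EFin_int// dual.
  have -> : (\int[leb]_(x in I01) (1 * \1_A' (T x))%:E = leb (I01 `&` T @^-1` A'))%E.
    transitivity (\int[leb]_(x in I01 `&` T @^-1` A') 1%:E)%E; last first.
      by rewrite integral_cst ?mul1e//; exact: mTI.
    rewrite integral_mkcondr; apply: eq_integral => x _.
    rewrite mul1r indicE /patch (_ : (x \in T @^-1` A') = (T x \in A')).
      by case: (_ \in _).
    by apply/idP/idP; rewrite !inE.
  move=> ->; rewrite /density_measure/= /density01 integral_mkcondl.
  apply: ae_eq_integral => //.
  - by apply/measurable_EFinP; exact: BV_measurable.
  - apply/(measurable_restrict _ _ _) => //; apply/measurable_EFinP.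
    by apply: measurableT_comp => //; apply: measurable_funS mt => // x [].
  - apply: filterS transfer1_ge0 => x e Ix.
    rewrite patchE indicE; case: ifPn => xA; last by rewrite mulr0.
    by rewrite mulr1 e.
- move=> k; rewrite m1E; apply: (@le_lt_trans _ _ (leb I01)).
    by apply: le_measure; rewrite ?inE//; exact: mTI.
  by rewrite lebesgue_I01 ltry.
Qed.

(** Nonsingularity of [T]: the image of Lebesgue measure has a density, so it does not charge null
    sets. *)
Lemma null_preimage (A : set R) : measurable A -> leb A = 0%E ->
  leb (I01 `&` T @^-1` A) = 0%E.
Proof.
move=> mA A0; rewrite preimage_density// /density01.
have mI := @measurable_I01 R.
apply: null_set_integral.
- exact: measurableI.
- apply/measurable_EFinP; apply: measurableT_comp => //.
  apply: (measurable_funS mI) => //.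
  by apply: BV_measurable; apply: BV_transfer; exact: BV_cst.
- by apply: (subset_measure0 _ _ _ A0) => //; exact: measurableI.
Qed.

Lemma aeq01_comp s t : aeq01 s t -> aeq01 (s \o T) (t \o T).
Proof.
move=> [N [mN N0 sN]]; exists (I01 `&` T @^-1` N); split.
- have := measurable_T Tpm (@measurable_I01 R) mN.
  by [].
- exact: null_preimage.
- move=> x /= H; have [Ix sx] : I01 x /\ s (T x) <> t (T x) by apply/not_implyP.
  split => //=; apply: sN => /= H'; apply: sx; apply: H'; exact: Tmaps.
Qed.

Lemma BV_comp g : BV g -> BV (g \o T).
Proof.
move=> /BVP[mg [g' jg' gg']]; apply/BVP; split; first exact: (measurable_compT Tmaps Tpm).
by exists (g' \o T); [exact: (jordan_comp Tmaps Tpm)|exact: aeq01_comp].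
Qed.

Lemma BV_comp_iter n g : BV g -> BV (fun x => g (iter n T x)).
Proof.
move=> Bg; elim: n => // n IH; have := BV_comp IH.
by congr BV; apply/funext => x; rewrite /= -iterSr.
Qed.

Lemma duality s g : BV s -> BV g ->
  intI (fun x => s x * g (T x)) = intI (fun x => transfer s x * g x).
Proof.
move=> Bs Bg; apply: duality_of_BV => //; first exact: BV_measurable.
by apply: BVM => //; exact: BV_comp.
Qed.

(** Each step trades one [T] on [g] for one [transfer] on [s]; this keeps the integral of [s], and
    [Psi (Phi s) = 0] leaves a pure power of [Psi]. The exponent starts at 1 because
    [P^n = Phi + Psi^n] fails for [n = 0]. *)
Lemma duality_iter n s g : BV s -> BV g ->
  intI (fun x => s x * g (iter n.+1 T x)) =
  intI s * int_eta h g + intI (fun x => iter n.+1 Psi s x * g x).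
Proof.
have base s' g' : BV s' -> BV g' -> intI (fun x => transfer s' x * g' x) =
    intI s' * int_eta h g' + intI (fun x => Psi s' x * g' x).
  move=> Bs Bg; rewrite /transfer; under eq_Rintegral do rewrite mulrDl.
  rewrite intD; last 2 first.
  - by apply: BVM => //; exact: BV_Phi.
  - by apply: BVM => //; exact: BV_Psi.
  congr (_ + _); rewrite /int_eta -intZ; last exact: BVM.
  by apply: eq_Rintegral => x _; rewrite /Phi; ring.
elim: n s => [|n IH] s Bs Bg; first by rewrite /= duality// base.
transitivity (intI (fun x => transfer s x * g (iter n.+1 T x))).
  rewrite -(@duality _ (fun x => g (iter n.+1 T x)))//; last exact: BV_comp_iter.
  by apply: eq_Rintegral => x _; rewrite -iterSr.
rewrite IH//; last exact: BV_transfer.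
rewrite int_transfer//; congr (_ + _).
have Bt := BV_transfer Bs; have BP := BV_Psi Bs.
apply: aeq01_int.
- by apply: measurable_funM; apply: BV_measurable => //; exact: BV_iter_Psi.
- by apply: measurable_funM; apply: BV_measurable => //; exact: BV_iter_Psi.
apply: aeq01M; last exact: aeq01W.
rewrite !iterSr; apply: aeq01_iter_Psi; do ?exact: BV_Psi.
case: SD => _ [_ _ PsiD _] [_ _ PsiPhi] _.
have := PsiD _ _ (BV_Phi s) BP; have := PsiPhi s Bs.
apply: filterS2 => x e1 e2 Ix; rewrite /transfer.
by have := e2 Ix; rewrite /= e1// add0r.
Qed.

End Spectral.

(** * Law of large numbers *)

Section Cesaro.
Context {R : realType}.

Lemma floor_sqrt (n : nat) : exists k, (k ^ 2 <= n < k.+1 ^ 2)%N.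
Proof.
elim: n => [|n [k /andP[k1 k2]]]; first by exists 0%N.
have [lt|ge] := ltnP n.+1 (k.+1 ^ 2); first by exists k; rewrite lt ltnW.
by exists k.+1; rewrite ge (leq_ltn_trans k2)// ltn_sqr.
Qed.

Lemma cesaro_along_squares (y : nat -> R) (C : R) : (forall k, `|y k| <= C) ->
  (fun k => (\sum_(i < k.+1 ^ 2) y i) / (k.+1 ^ 2)%:R) @ \oo --> 0 ->
  (fun n => (\sum_(i < n) y i) / n%:R) @ \oo --> 0.
Proof.
move=> yC lim0.
have C0 : 0 <= C by apply: le_trans (yC 0%N).
have incr a b : (a <= b)%N ->
    `|\sum_(i < b) y i - \sum_(i < a) y i| <= C * (b - a)%:R.
  move=> ab; suff {ab}: forall d, `|\sum_(i < a + d) y i - \sum_(i < a) y i| <= C * d%:R.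
    by move=> /(_ (b - a)%N); rewrite subnKC.
  move=> d; rewrite big_split_ord/= addrAC subrr add0r.
  rewrite (le_trans (ler_norm_sum _ _ _))//.
  rewrite (le_trans (ler_sum _ (fun (i : 'I_d) _ => yC (a + i)%N)))//.
  by rewrite sumr_const card_ord mulr_natr.
apply/cvgrPdist_lt => e e0.
move/cvgrPdist_lt : lim0 => /(_ (e / 2)); rewrite divr_gt0// => /(_ isT) [K _ HK].
(* Past the square [(k+1)^2] there remain at most [2(k+1)] terms of size at most [C]. Once
   [k+1 > 4C/e] their sum is at most [e/2 * (k+1)^2], hence at most [e/2 * n]. *)
pose L := Num.bound (4 * C / e).
exists ((K + L).+2 ^ 2)%N => // n /= nK.
have [k /andP[k1 k2]] := floor_sqrt n.
have kKL : (K + L < k.-1)%N.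
  have : ((K + L).+2 < k.+1)%N by rewrite -ltn_sqr (leq_ltn_trans nK).
  by case: k {k1 k2} => // k; rewrite !ltnS.
case: k k1 k2 kKL => // k k1 k2 /= kKL.
have n0 : 0 < n%:R :> R by rewrite ltr0n (leq_trans _ k1)// expn_gt0.
rewrite sub0r normrN normrM normfV [X in _ / X]gtr0_norm// ltr_pdivrMr//.
have /= := HK k (leq_trans (leq_addr L K) (ltnW kKL)).
have k0 : 0 < (k.+1 ^ 2)%:R :> R by rewrite ltr0n expn_gt0.
rewrite sub0r normrN normrM normfV [X in _ / X]gtr0_norm// ltr_pdivrMr// => sk.
have sn := incr _ _ k1.
have k1' : (k.+1 ^ 2)%:R <= n%:R :> R by rewrite ler_nat.
have nk : (n - k.+1 ^ 2)%:R <= 2 * k.+1%:R :> R.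
  by rewrite -natrM ler_nat leq_subLR; move: k2; rewrite -!mulnn; lia.
have Lk : 4 * C / e < k.+1%:R.
  apply: (lt_le_trans (archi_boundP _)); first by rewrite divr_ge0// ?mulr_ge0// ltW.
  by rewrite ler_nat; move: kKL; rewrite /L; lia.
have : 4 * C < k.+1%:R * e by rewrite -ltr_pdivrMr.
have tri : `|\sum_(i < n) y i| <= `|\sum_(i < k.+1 ^ 2) y i| +
    `|\sum_(i < n) y i - \sum_(i < k.+1 ^ 2) y i|.
  by rewrite (le_trans _ (ler_normD _ _))// addrC subrK.
have : C * (n - k.+1 ^ 2)%:R <= C * (2 * k.+1%:R) by rewrite ler_wpM2l.
have k2E : (k.+1 ^ 2)%:R = k.+1%:R ^+ 2 :> R by rewrite natrX.
rewrite k2E in sk k1' sn nk *.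
have K0 : 0 < k.+1%:R :> R by rewrite ltr0n.
move: sk k1' sn tri; move: (\sum_(i < n) _) (\sum_(i < _) _) => A B.
move: `|A| `|B| `|A - B| => a b c sk k1' sn tri h1 h2.
have : C * (2 * k.+1%:R) <= e / 2 * n%:R.
  apply: (@le_trans _ _ (e / 2 * k.+1%:R ^+ 2)); last by rewrite ler_pM2l// divr_gt0.
  have := ltW h2; rewrite -(ler_pM2l K0); nra.
have : e / 2 * k.+1%:R ^+ 2 <= e / 2 * n%:R by rewrite ler_pM2l// divr_gt0.
lra.
Qed.

End Cesaro.

(** * Decay of correlations, variance of Birkhoff sums, almost sure convergence of averages *)

Section LLN.
Context {R : realType}.
Implicit Types (f g s t u v w : R -> R) (x y : R) (I : interval R).
Local Notation leb := (@lebesgue_measure R).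
Local Notation I01 := (@I01 R).
Variables (T : R -> R) (parts : seq (interval R)) (h : R -> R).
Variables (Psi : (R -> R) -> R -> R) (M q : R).
Hypothesis Tmaps : maps_unit_interval T.
Hypothesis Tpm : piecewise_monotonic T parts.
Hypothesis SD : spectral_decomposition T parts h Psi M q.

Let BVh : BV h. Proof. by case: SD => -[]. Qed.
Let h_ge0 x : I01 x -> 0 <= h x. Proof. by case: SD => -[_ H _ _] _ _ _; exact: H. Qed.
Let int_h : \int[leb]_(x in I01) h x = 1. Proof. by case: SD => -[]. Qed.
Local Notation E := (int_eta h).
Let BVT := BV_comp Tmaps Tpm SD.
Let BViter := BV_comp_iter Tmaps Tpm SD.

Lemma int_etaD f g : BV f -> BV g -> E (fun x => f x + g x) = E f + E g.
Proof.
move=> Bf Bg; rewrite /int_eta -intD; [|exact: BVM|exact: BVM].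
by apply: eq_Rintegral => x _; rewrite mulrDl.
Qed.

Lemma int_etaZ (c : R) f : BV f -> E (fun x => c * f x) = c * E f.
Proof.
move=> Bf; rewrite /int_eta -intZ; last exact: BVM.
by apply: eq_Rintegral => x _; rewrite mulrA.
Qed.

Lemma int_eta_cst (c : R) : E (fun=> c) = c.
Proof. by rewrite /int_eta intZ// int_h mulr1. Qed.

Lemma eq_int_eta f g : (forall x, I01 x -> f x = g x) -> E f = E g.
Proof. by move=> fg; apply: eq_Rintegral => x /set_mem Ix; rewrite fg. Qed.

Lemma le_int_eta f g : BV f -> BV g -> (forall x, I01 x -> f x <= g x) -> E f <= E g.
Proof.
move=> Bf Bg fg; apply: le_Rintegral.
- exact: measurable_I01.
- by apply: BV_integrable; exact: BVM.
- by apply: BV_integrable; exact: BVM.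
- by move=> x Ix; rewrite ler_wpM2r ?h_ge0 ?fg.
Qed.

(** This is the duality with [s = h], combined with [P h = h]. *)
Lemma int_eta_comp g : BV g -> E (g \o T) = E g.
Proof.
move=> Bg; rewrite /int_eta.
transitivity (\int[leb]_(x in I01) (h x * g (T x))).
  by apply: eq_Rintegral => x _; rewrite mulrC.
rewrite (duality Tmaps Tpm SD)//; apply: aeq01_int.
- by apply: BV_measurable; apply: BVM => //; exact: (BV_transfer SD).
- by apply: BV_measurable; exact: BVM.
have [[_ _ _ e1] _ _ _] := SD; have e2 := PF_transfer SD BVh.
apply: filterS2 e1 e2 => x e1 e2 Ix.
by rewrite -e2// e1// mulrC.
Qed.

Lemma correlation n f g : BV f -> BV g ->
  E (fun x => f x * g (iter n.+1 T x)) = E f * E g +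
  \int[leb]_(x in I01) (iter n.+1 Psi (fun x => f x * h x) x * g x).
Proof.
move=> Bf Bg; rewrite /int_eta -(duality_iter Tmaps Tpm SD)//; last exact: BVM.
by apply: eq_Rintegral => x _; rewrite mulrAC.
Qed.

Lemma bvnorm_fin s : BV s -> (bvnorm s \is a fin_num).
Proof.
move=> [/integrableP[ms intS] vs]; rewrite ge0_fin_numE; last first.
  by rewrite le_max integral_ge0.
by rewrite gt_max vs andbT.
Qed.

(** The integral is at most the sup of [|g|] times the L1 norm of [Psi^n (f h)]; the L1 norm is
    dominated by the BV norm, to which the spectral gap applies. *)
Lemma correlation_decay f g : BV f -> BV g ->
  (exists C : R, forall x, I01 x -> `|g x| <= C) ->
  exists2 D, 0 <= D & forall n,
  `|\int[leb]_(x in I01) (iter n Psi (fun x => f x * h x) x * g x)| <= D * q ^+ n.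
Proof.
move=> Bf Bg [C gC]; have mI := @measurable_I01 R.
have Bfh := BVM Bf BVh.
have C0 : 0 <= C by apply: le_trans (gC 0 _) => //; rewrite I01P lexx ler01.
have [_ _ _ [M0 /andP[q0 q1] Psin]] := SD.
pose K := fine (bvnorm (fun x => f x * h x)).
have K0 : 0 <= K by apply: fine_ge0; rewrite le_max integral_ge0.
exists (C * (M * K)) => [|n]; first by rewrite !mulr_ge0// ltW.
have Bs := BV_iter_Psi SD n Bfh.
set s := iter n Psi _ in Bs *.
have ints : leb.-integrable I01 (EFin \o (fun x => `|s x|)).
  by apply: integrable_norm; exact: BV_integrable.
apply: le_trans.
  by apply: le_normr_Rintegral => //; apply: BV_integrable; exact: BVM.
apply: (@le_trans _ _ (C * \int[leb]_(x in I01) `|s x|)).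
  rewrite -RintegralZl//; apply: le_Rintegral => //.
  - apply: integrable_norm; apply: BV_integrable; exact: BVM.
  - rewrite (_ : _ \o _ = (fun x => C%:E * (EFin \o (fun x => `|s x|%R)) x)%E) //.
    exact: integrableZl.
  - by move=> x Ix; rewrite normrM mulrC ler_wpM2r// gC.
rewrite -!mulrA ler_wpM2l// -lee_fin mulrCA [K * _]mulrC -mulrA mulrA EFinM.
rewrite [X in (X <= _)%E](_ : _ = \int[leb]_(x in I01) (`|s x|)%:E)%E; last first.
  by rewrite /Rintegral fineK//; apply: integrable_fin_num => //; exact: ints.
apply: (@le_trans _ _ (bvnorm s)); first by rewrite le_max lexx.
rewrite /K [X in (_ <= _ * X)%E](_ : _ = bvnorm (fun x => f x * h x)); last first.
  by rewrite fineK// bvnorm_fin.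
exact: Psin Bfh.
Qed.

Section Centered.
Variables (Y : R -> R) (C : R).
Hypothesis BY : BV Y.
Hypothesis YC : forall x, I01 x -> `|Y x| <= C.
Hypothesis EY : E Y = 0.

Let S n x := \sum_(k < n) Y (iter k T x).

Lemma BV_orbit_sum n : BV (S n).
Proof. by apply: (@BV_sum _ (fun k x => Y (iter k T x))) => k; exact: BViter. Qed.

(** Expand the square of [S_(n+1) = Y + S_n o T]. By invariance the last square has the expectation
    of [S_n^2], so each step adds at most [C^2] plus twice the cross term, and the latter is bounded
    uniformly in [n]. *)
Lemma variance_bound : exists2 B, 0 <= B & forall n, E (fun x => S n x ^+ 2) <= B * n%:R.
Proof.
have [D D0 HD] := correlation_decay BY BY (ex_intro _ C YC).
have [_ _ _ [M0 /andP[q0 q1] _]] := SD.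
have I0 : I01 0 by rewrite I01P lexx ler01.
have C0 : 0 <= C by exact: le_trans (YC I0).
have q1' : 0 < 1 - q by rewrite subr_gt0.
have BST n : BV (fun x => S n (T x)) by apply: (BVT (BV_orbit_sum n)).
(* The right-hand side is the geometric sum of [D * q^k] over [k < n]; this closed form lets the
   induction go through. Since [E Y = 0], the term added at step [n] is a pure correlation at lag
   [n+1]. *)
have cross n : E (fun x => Y x * S n (T x)) <= D / (1 - q) * (1 - q ^+ n).
  elim: n => [|n IH].
    rewrite expr0 subrr mulr0 (@eq_int_eta _ (fun=> 0)) ?int_eta_cst// => x _.
    by rewrite /S big_ord0 mulr0.
  rewrite (@eq_int_eta _ (fun x => Y x * S n (T x) + Y x * Y (iter n.+1 T x))); last first.
    by move=> x _; rewrite /S big_ord_recr/= mulrDr -iterSr.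
  rewrite int_etaD; [|exact: BVM|by apply: BVM => //; exact: BViter].
  rewrite correlation// EY mul0r add0r.
  have := HD n.+1; rewrite ler_norml => /andP[_ h1].
  apply: (le_trans (lerD IH h1)).
  have -> : D / (1 - q) * (1 - q ^+ n.+1) = D / (1 - q) * (1 - q ^+ n) + D * q ^+ n.
    by rewrite exprS; field; rewrite gt_eqF.
  rewrite lerD2l ler_wpM2l// exprS ler_piMl// ?exprn_ge0// ltW//.
have cross' n : E (fun x => Y x * S n (T x)) <= D / (1 - q).
  apply: (le_trans (cross n)); rewrite ler_piMr ?divr_ge0// ?(ltW q1')//.
  by rewrite gerBl exprn_ge0// ltW.
exists (C ^+ 2 + 2 * (D / (1 - q))) => [|n].
  by rewrite addr_ge0 ?sqr_ge0// mulr_ge0// divr_ge0// ltW.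
elim: n => [|n IH].
  rewrite mulr0 (@eq_int_eta _ (fun=> 0)) ?int_eta_cst// => x _.
  by rewrite /S big_ord0 expr0n.
have BY2 : BV (fun x => Y x ^+ 2) by under eq_fun do rewrite expr2; exact: BVM.
have BS2 : BV (fun x => S n x ^+ 2).
  by under eq_fun do rewrite expr2; apply: BVM; exact: BV_orbit_sum.
have BYS : BV (fun x => Y x * S n (T x)) by apply: BVM.
rewrite (@eq_int_eta _ (fun x => Y x ^+ 2 + 2 * (Y x * S n (T x)) + S n (T x) ^+ 2)).
  rewrite int_etaD; [|by apply: BVD => //; apply: BVM => //; exact: BV_cst|exact: (BVT BS2)].
  rewrite int_etaD//; last by apply: BVM => //; exact: BV_cst.
  rewrite int_etaZ// -[X in _ + X]/(E ((fun x => S n x ^+ 2) \o T)) int_eta_comp//.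
  have : E (fun x => Y x ^+ 2) <= C ^+ 2.
    rewrite -[leRHS]int_eta_cst; apply: le_int_eta => //; first exact: BV_cst.
    by move=> x Ix; rewrite -real_normK ?num_real// lerXn2r ?nnegrE// YC.
  have := cross' n; rewrite -[n.+1%:R]natr1.
  by move: IH; lra.
move=> x _; rewrite /S big_ord_recl/=.
rewrite (eq_bigr (fun k : 'I_n => Y (iter k T (T x)))); last by move=> k _; rewrite -iterSr.
by ring.
Qed.

(** The integrals of the squared averages along squares, weighted by [h], have a finite sum. So the
    series of these functions is finite off a null set and its terms tend to 0; where [h x > 0] the
    weight can be divided out. *)
Lemma orbit_average_cvg0 : exists N, [/\ measurable N, leb N = 0%E &
  forall x, I01 x -> ~ N x -> 0 < h x -> (fun n => S n x / n%:R) @ \oo --> 0].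
Proof.
have [B B0 HB] := variance_bound.
pose g k x := (S (k.+1 ^ 2)%N x / (k.+1 ^ 2)%:R) ^+ 2 * h x.
have mI := @measurable_I01 R.
have g0 k x : I01 x -> 0 <= g k x by move=> Ix; rewrite mulr_ge0 ?sqr_ge0 ?h_ge0.
have Bg k : BV (g k).
  apply: BVM => //; under eq_fun do rewrite expr2.
  by apply: BVM; apply: BVM; do ?[exact: BV_orbit_sum|exact: BV_cst].
have mg k : measurable_fun I01 (fun x => (g k x)%:E).
  by apply/measurable_EFinP; exact: BV_measurable.
have Eg k : \int[leb]_(x in I01) g k x <= B / (k.+1 ^ 2)%:R.
  rewrite -/(E (fun x => (S (k.+1 ^ 2)%N x / (k.+1 ^ 2)%:R) ^+ 2)).
  have k0 : 0 < (k.+1 ^ 2)%:R :> R by rewrite ltr0n expn_gt0.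
  rewrite (@eq_int_eta _ (fun x => ((k.+1 ^ 2)%:R ^- 2) * S (k.+1 ^ 2)%N x ^+ 2)).
    rewrite int_etaZ; last first.
      by under eq_fun do rewrite expr2; apply: BVM; exact: BV_orbit_sum.
    rewrite mulrC ler_pdivrMr ?exprn_gt0// (le_trans (HB _))//.
    by rewrite expr2 mulrA divfK// gt_eqF.
  by move=> x _; rewrite exprMn mulrC exprVn.
(* Telescoping majorant: [1/a^2 <= 2/a - 2/(a+1)] for [a >= 1]. *)
have sumB n : \sum_(k < n) B / (k.+1 ^ 2)%:R <= B * 2.
  apply: (@le_trans _ _ (B * (2 * (1 - n.+1%:R^-1)))); last first.
    by rewrite ler_wpM2l// ler_piMr// gerBl invr_ge0.
  elim: n => [|n IH]; first by rewrite big_ord0 invr1 subrr !mulr0.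
  rewrite big_ord_recr/= (le_trans (lerD IH (lexx _)))// -mulrDr ler_wpM2l//.
  have a0 : 0 < n.+1%:R :> R by rewrite ltr0n.
  have a1 : 1 <= n.+1%:R :> R by rewrite ler1n.
  rewrite natrX -[n.+2%:R]natr1; move: (n.+1%:R) a0 a1 => a a0 a1.
  rewrite -subr_ge0.
  have -> : 2 * (1 - (a + 1)^-1) - (2 * (1 - a^-1) + (a ^+ 2)^-1) =
      (a - 1) / (a ^+ 2 * (a + 1)).
    by field; rewrite !gt_eqF//; lra.
  by rewrite divr_ge0 ?subr_ge0// mulr_ge0 ?sqr_ge0//; lra.
have sumfin : (\int[leb]_(x in I01) (\sum_(k <oo) (g k x)%:E) < +oo)%E.
  have g0' k x : I01 x -> (0 <= (g k x)%:E)%E by move=> Ix; rewrite lee_fin g0.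
  rewrite (integral_nneseries leb mI mg g0').
  apply: (@le_lt_trans _ _ (B * 2)%:E); last exact: ltry.
  apply: lime_le.
    by apply: is_cvg_nneseries => k _ _; apply: integral_ge0 => x Ix; rewrite lee_fin g0.
  apply: nearW => n; rewrite big_mkord.
  apply: (@le_trans _ _ (\sum_(k < n) B / (k.+1 ^ 2)%:R)%:E); last first.
    by rewrite lee_fin; exact: (sumB n).
  rewrite -sumEFin; apply: lee_sum => k _.
  by rewrite -EFin_int// lee_fin.
have mG : measurable_fun I01 (fun x => \sum_(k <oo) (g k x)%:E)%E.
  by apply: ge0_emeasurable_sum => // k x Ix _; rewrite lee_fin g0.
have G0 x : I01 x -> (0 <= \sum_(k <oo) (g k x)%:E)%E.
  by move=> Ix; apply: nneseries_ge0 => k _ _; rewrite lee_fin g0.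
have iG : leb.-integrable I01 (fun x => \sum_(k <oo) (g k x)%:E)%E.
  apply/integrableP; split => //.
  apply: le_lt_trans sumfin; rewrite le_eqVlt; apply/orP; left; apply/eqP.
  by apply: eq_integral => x /set_mem Ix; rewrite gee0_abs// G0.
have [N [mN N0 sN]] :=
  integrable_ae (measurable_I01 : measurable (I01 : set (measurableTypeR R))) iG.
exists N; split => // x Ix Nx hx.
have Gx : (\sum_(k <oo) (g k x)%:E)%E \is a fin_num.
  by apply: contrapT => Gx; apply: Nx; apply: sN => /= H; apply: Gx; exact: H.
have gcvg : g ^~ x @ \oo --> 0.
  apply: cvg_series_cvg_0.
  apply: nondecreasing_is_cvgn.
    by apply/nondecreasing_seqP => n; rewrite /series/= big_nat_recr//= lerDl g0.
  exists (fine (\sum_(k <oo) (g k x)%:E)%E) => _ [n _ <-].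
  rewrite -lee_fin fineK// /series/= -sumEFin.
  by apply: nneseries_lim_ge => k _ _; rewrite lee_fin g0.
apply: (@cesaro_along_squares _ (fun k => Y (iter k T x)) C).
  by move=> k; apply: YC; exact: maps_iter.
apply/cvgrPdist_lt => e e0.
move/cvgrPdist_lt : gcvg => /(_ (e ^+ 2 * h x)).
rewrite mulr_gt0 ?exprn_gt0// => /(_ isT); apply: filterS => k.
rewrite !sub0r !normrN ger0_norm ?g0// /g ltr_pM2r//.
rewrite -[X in X < _]real_normK ?num_real//.
by rewrite ltr_pXn2r ?nnegrE// ltW.
Qed.

End Centered.

Theorem law_of_large_numbers f : BV f -> (exists C : R, forall x, I01 x -> `|f x| <= C) ->
  exists N, [/\ measurable N, leb N = 0%E & forall x, I01 x -> ~ N x -> 0 < h x ->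
  (fun n => (\sum_(k < n) f (iter k T x)) / n%:R) @ \oo --> E f].
Proof.
move=> Bf [C fC].
have BY : BV (fun x => f x - E f) by apply: BVB => //; exact: BV_cst.
have YC x : I01 x -> `|f x - E f| <= C + `|E f|.
  by move=> Ix; rewrite (le_trans (ler_normB _ _))// lerD2r fC.
have EY : E (fun x => f x - E f) = 0.
  by rewrite int_etaD//; [rewrite int_eta_cst subrr|exact: BV_cst].
have [N [mN N0 HN]] := orbit_average_cvg0 BY YC EY.
exists N; split => // x Ix Nx hx; have := HN x Ix Nx hx.
move=> /(cvgD (cvg_cst (E f))); rewrite addr0.
apply: cvg_trans; apply: near_eq_cvg; near=> n.
have n0 : n%:R != 0 :> R by rewrite pnatr_eq0 -lt0n; near: n; exists 1%N.
rewrite -[LHS]/(E f + (\sum_(k < n) (f (iter k T x) - E f)) / n%:R).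
rewrite sumrB sumr_const card_ord -[X in _ - X]mulr_natr mulrBl mulfK//.
by rewrite addrC subrK.
Unshelve. all: by end_near. Qed.

End LLN.

(** * Autocorrelation of return times *)

Section Autocorrelation.
Context {R : realType}.
Variables (T f : R -> R) (y : R).
Let w := return_weights T f y.
Let a k := f (iter k T y).

Lemma restr_ge0 n (k : nat) : restr n w k%:Z = if (k <= n)%N then a k else 0.
Proof. by rewrite /restr /w /return_weights absz_nat. Qed.

Lemma restr_lt0 n (k : int) : k < 0 -> restr n w k = 0.
Proof. by move=> k0; rewrite /restr /w /return_weights leNgt k0 /=; case: ifP. Qed.

(** The weights vanish on negative integers, so only the indices [k] with both [k] and [k - z] in
    [[0, n]] contribute. There are [n + 1 - |z|] of them, and truncated subtraction yields the empty
    sum when [|z| > n]. *)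
Lemma autocorr_approxE n (z : int) : autocorr_approx w n z =
  (n.*2.+1)%:R^-1 * \sum_(j < n.+1 - `|z|) a j * a (`|z| + j)%N.
Proof.
rewrite /autocorr_approx; congr (_ * _).
transitivity (\sum_(j < n.+1) a j * restr n w (j%:Z - z)).
  have -> : n.*2.+1 = (n + n.+1)%N by lia.
  rewrite big_split_ord/= big1 ?add0r => [|i _]; last first.
    by rewrite restr_lt0 ?mul0r//; have := ltn_ord i; lia.
  apply: eq_bigr => i _.
  have -> : (n + i)%N%:Z - n%:Z = i%:Z by lia.
  by rewrite restr_ge0 -ltnS ltn_ord.
have [z_large|z_small] := ltnP n `|z|.
  have -> : (n.+1 - `|z| = 0)%N by lia.
  rewrite big_ord0 big1// => i _; have := ltn_ord i; case: z z_large => p /= plt ilt.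
    by rewrite restr_lt0 ?mulr0//; lia.
  have -> : i%:Z - Negz p = (i + p.+1)%N%:Z by lia.
  by rewrite restr_ge0 ifF ?mulr0//; lia.
case: z z_small => p; rewrite ?absz_nat => ple.
  have E : (n.+1 = p + (n.+1 - p))%N by lia.
  move: (n.+1 - p)%N E => d E; rewrite E.
  rewrite big_split_ord/= big1 ?add0r => [|i _]; last first.
    by rewrite restr_lt0 ?mulr0//; have := ltn_ord i; lia.
  apply: eq_bigr => i _.
  have -> : (p + i)%N%:Z - p%:Z = i%:Z by lia.
  rewrite restr_ge0 ifT; first by rewrite mulrC.
  by have := ltn_ord i; lia.
rewrite NegzE abszN absz_nat in ple *.
have E : (n.+1 = (n.+1 - p.+1) + p.+1)%N by lia.
move: (n.+1 - p.+1)%N E => d E; rewrite E.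
rewrite big_split_ord/= [X in _ + X]big1 ?addr0 => [|i _]; last first.
  have -> : (d + i)%N%:Z - - p.+1%:Z = (d + i + p.+1)%N%:Z by lia.
  by rewrite restr_ge0 ifF ?mulr0//; lia.
apply: eq_bigr => i _.
have -> : i%:Z - - p.+1%:Z = (p.+1 + i)%N%:Z by lia.
rewrite restr_ge0 ifT//; have := ltn_ord i; lia.
Qed.

(** Origin of the factor 1/2: for [n = m + p] and [|z| = p], [m + 1] terms survive in a window of
    length [2n + 1]. *)
Lemma ratio_cvg_half (p : nat) :
  (fun m : nat => m.+1%:R / ((m + p).*2.+1)%:R : R) @ \oo --> (2^-1 : R).
Proof.
pose c : R := 2 * p%:R - 1.
have -> : (fun m : nat => m.+1%:R / ((m + p).*2.+1)%:R : R) =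
    (fun m => 2^-1 - 2^-1 * (c / ((m + p).*2.+1)%:R)).
  apply/funext => m; rewrite /c -addn1 -[in LHS]muln2 -addn1 -muln2.
  rewrite !(natrD, natrM); field.
  by rewrite gt_eqF// ltr_pwDl// mulr_ge0// addr_ge0.
rewrite -[X in _ --> X]subr0; apply: cvgB; first exact: cvg_cst.
rewrite -[X in _ --> X](mulr0 2^-1); apply: cvgM; first exact: cvg_cst.
apply: norm_cvg0; apply: (@squeeze_cvgr _ _ _ _ (fun=> 0) (fun m => `|c| * harmonic m)).
- apply: nearW => m; rewrite normr_ge0/= normrM ler_wpM2l//.
  rewrite normfV ger0_norm// /harmonic lef_pV2 ?posrE ?ltr0n// ler_nat; lia.
- exact: cvg_cst.
- by rewrite -[X in _ --> X](mulr0 `|c|); apply: cvgM; [exact: cvg_cst|exact: cvg_harmonic].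
Qed.

Lemma autocorr_cvg (z : int) (L : R) :
  (fun n => (\sum_(i < n) a i * a (`|z| + i)%N) / n%:R) @ \oo --> L ->
  autocorr_approx w n z @[n --> \oo] --> 2^-1 * L.
Proof.
move=> HL; rewrite -(cvg_shiftn `|z|%N).
have -> : (fun n => autocorr_approx w (n + `|z|)%N z) =
  (fun n => n.+1%:R / ((n + `|z|).*2.+1)%:R *
    ((\sum_(i < n.+1) a i * a (`|z| + i)%N) / n.+1%:R)).
  apply/funext => n; rewrite autocorr_approxE.
  by rewrite -addSn addnK [RHS]mulrC -mulrA mulKf ?pnatr_eq0// mulrC.
apply: cvgM; first exact: ratio_cvg_half.
by move: HL; rewrite -(cvg_shiftS (fun n => (\sum_(i < n) a i * a (`|z| + i)%N) / n%:R)).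
Qed.

End Autocorrelation.

(** * Almost sure autocorrelation of the return time measure *)

Section ReturnTimes.
Context {R : realType}.
Local Notation leb := (@lebesgue_measure R).
Local Notation I01 := (@I01 R).
Variables (T : R -> R) (parts : seq (interval R)) (h : R -> R).
Variables (Psi : (R -> R) -> R -> R) (M q : R) (f : R -> R).
Hypothesis Tmaps : maps_unit_interval T.
Hypothesis Tpm : piecewise_monotonic T parts.
Hypothesis SD : spectral_decomposition T parts h Psi M q.
Hypothesis Bf : BV f.
Hypothesis f_bounded : exists C : R, forall x, I01 x -> `|f x| <= C.

Let BVh : BV h. Proof. by case: SD => -[]. Qed.
Let h_ge0 x : I01 x -> 0 <= h x. Proof. by case: SD => -[_ H _ _] _ _ _; exact: H. Qed.

(** The separate value of [coef_c] at 0 makes the formula uniform in [z]: the iterated duality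
    covers positive lags, and at lag 0 the variance plays the same role. *)
Lemma lag_correlation (z : int) :
  int_eta h (fun x => f x * f (iter `|z| T x)) = int_eta h f ^+ 2 + coef_c Psi h f z.
Proof.
rewrite /coef_c; case: eqP => [->|/eqP z0].
  by rewrite absz0 addrC subrK; apply: eq_Rintegral => x _; rewrite expr2.
have -> : `|z|%N = `|z|.-1.+1 by rewrite prednK// absz_gt0.
by rewrite (correlation Tmaps Tpm SD)// expr2.
Qed.

Lemma coef_c_decay : exists2 D, 0 <= D &
  forall z : int, `|coef_c Psi h f z| <= D * q ^+ `|z|.
Proof.
have [D D0 HD] := correlation_decay SD Bf Bf f_bounded.
have [_ _ _ [_ /andP[q0 q1] _]] := SD.
exists (D + `|coef_c Psi h f 0|) => [|z]; first by rewrite addr_ge0.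
have [->|z0] := eqVneq z 0; first by rewrite absz0 expr0 mulr1 lerDr.
rewrite {1}/coef_c (negbTE z0) (le_trans (HD _))// ler_wpM2r ?exprn_ge0 ?(ltW q0)//.
by rewrite lerDl.
Qed.

Lemma coef_cN (z : int) : coef_c Psi h f (- z) = coef_c Psi h f z.
Proof. by rewrite /coef_c oppr_eq0 abszN. Qed.

(** One exceptional set must serve all lags: it is the countable union of the Lebesgue-null sets for
    [f * f o T^p], together with the set [Z] where [h <= 0]. As [h] is non-negative, it vanishes on
    [Z], so [Z] is null for eta whatever its Lebesgue measure. *)
Lemma autocorrelation_ae : exists N, [/\ measurable N, eta_h h N = 0%E &
  forall y, I01 y -> ~ N y -> forall z,
    autocorr_approx (return_weights T f y) n z @[n --> \oo] -->
    2^-1 * (int_eta h f ^+ 2 + coef_c Psi h f z)].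
Proof.
have mI := @measurable_I01 R.
pose F p x := f x * f (iter p T x).
have BF p : BV (F p) by apply: BVM => //; exact: (BV_comp_iter Tmaps Tpm SD).
have [C fC] := f_bounded.
have Fb p : exists C', forall x, I01 x -> `|F p x| <= C'.
  by exists (C * C) => x Ix; rewrite normrM ler_pM// fC//; exact: maps_iter.
have H p := law_of_large_numbers Tmaps Tpm SD (BF p) (Fb p).
pose N p := projT1 (cid (H p)).
have HN p : [/\ measurable (N p), leb (N p) = 0%E & forall x, I01 x -> ~ N p x -> 0 < h x ->
  (fun n => (\sum_(k < n) F p (iter k T x)) / n%:R) @ \oo --> int_eta h (F p)].
  exact: (projT2 (cid (H p))).
pose Z := I01 `&` h @^-1` [set r | r <= 0].
have mZ : measurable Z.
  apply: (BV_measurable BVh) => //.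
  have -> : [set r | r <= 0] = `]-oo, 0]%classic :> set R.
    by apply/seteqP; split=> x /=; rewrite in_itv.
  exact: measurable_itv.
have mN : measurable (\bigcup_p N p) by apply: bigcup_measurable => p _; case: (HN p).
have N0 : leb (\bigcup_p N p) = 0%E.
  apply/(negligibleP _ mN); apply: negligible_bigcup => p.
  by have [mNp N0 _] := HN p; apply/negligibleP.
exists (Z `|` \bigcup_p N p); split.
- exact: measurableU.
- rewrite /eta_h; set D := _ `&` _.
  have mD : measurable D by apply: measurableI => //; exact: measurableU.
  rewrite (ae_eq_integral (cst 0%E)) ?integral0//.
    apply/measurable_EFinP; apply: (measurable_funS mI); last exact: BV_measurable.
    by move=> x [].
  exists (\bigcup_p N p); split => // x /= /not_implyP[[[[_ hx]|//] Ix] hx0].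
  exfalso; apply: hx0; congr EFin; apply/eqP; rewrite eq_le hx h_ge0//.
- move=> y Iy Ny z; rewrite -lag_correlation.
  have [_ _ /(_ y Iy) HF] := HN `|z|%N.
  apply: autocorr_cvg; have := HF _ _; rewrite /F => HF'.
  have : (fun n => (\sum_(k < n) f (iter k T y) * f (iter `|z| T (iter k T y))) / n%:R)
     @ \oo --> int_eta h (F `|z|%N).
    apply: HF'; first by move=> Nz; apply: Ny; right; exists `|z|%N.
    rewrite ltNge; apply/negP => hy; apply: Ny; left; split => //.
  have -> : (fun n => (\sum_(k < n) f (iter k T y) * f (iter `|z| T (iter k T y))) / n%:R) =
    (fun n => (\sum_(i < n) f (iter i T y) * f (iter (`|z| + i) T y)) / n%:R).
    by apply/funext => n; congr (_ / _); apply: eq_bigr => k _; rewrite iterD.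
  by [].
Qed.

End ReturnTimes.

(** * Integration over the circle *)

Section BoundedMeasurable.
Context {R : realType}.
Local Notation leb := (@lebesgue_measure R).
Local Notation I01 := (@I01 R).
Let mI := @measurable_I01 R.

Section Generic.
Context d (X : measurableType d).
Implicit Types (k : X -> R) (H : X -> R[i]).

(** Imposed on the whole space rather than on [0,1], so that translates and reflections stay in the
    class. *)
Definition bmeas k := measurable_fun setT k /\ exists C, forall x, `|k x| <= C.

Lemma bmeas_cst (c : R) : bmeas (fun=> c).
Proof. by split; [exact: measurable_cst|exists `|c|]. Qed.

Lemma bmeasD k1 k2 : bmeas k1 -> bmeas k2 -> bmeas (fun x => k1 x + k2 x).
Proof.
move=> [m1 [C1 H1]] [m2 [C2 H2]]; split; first exact: measurable_funD.
by exists (C1 + C2) => x; rewrite (le_trans (ler_normD _ _))// lerD.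
Qed.

Lemma bmeasM k1 k2 : bmeas k1 -> bmeas k2 -> bmeas (fun x => k1 x * k2 x).
Proof.
move=> [m1 [C1 H1]] [m2 [C2 H2]]; split; first exact: measurable_funM.
by exists (C1 * C2) => x; rewrite normrM ler_pM.
Qed.

Lemma bmeasN k : bmeas k -> bmeas (fun x => - k x).
Proof.
by move=> bk; under eq_fun do rewrite -mulN1r; apply: bmeasM => //; exact: bmeas_cst.
Qed.

Lemma bmeasB k1 k2 : bmeas k1 -> bmeas k2 -> bmeas (fun x => k1 x - k2 x).
Proof. by move=> b1 b2; apply: bmeasD => //; exact: bmeasN. Qed.

Definition cbmeas H := bmeas (fun x => complex.Re (H x)) /\ bmeas (fun x => complex.Im (H x)).

Lemma cbmeas_cst (c : R[i]) : cbmeas (fun=> c).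
Proof. by split; exact: bmeas_cst. Qed.

Lemma cbmeasD H1 H2 : cbmeas H1 -> cbmeas H2 -> cbmeas (fun x => H1 x + H2 x).
Proof.
move=> [r1 i1] [r2 i2]; split.
  by have := bmeasD r1 r2; congr bmeas; apply/funext => x; case: (H1 x); case: (H2 x).
by have := bmeasD i1 i2; congr bmeas; apply/funext => x; case: (H1 x); case: (H2 x).
Qed.

Lemma cbmeasM H1 H2 : cbmeas H1 -> cbmeas H2 -> cbmeas (fun x => H1 x * H2 x).
Proof.
move=> [r1 i1] [r2 i2]; split.
  have := bmeasB (bmeasM r1 r2) (bmeasM i1 i2).
  by congr bmeas; apply/funext => x; case: (H1 x); case: (H2 x).
have := bmeasD (bmeasM r1 i2) (bmeasM i1 r2).
by congr bmeas; apply/funext => x; case: (H1 x); case: (H2 x).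
Qed.

Lemma cbmeasJ H : cbmeas H -> cbmeas (fun x => (H x)^*).
Proof.
move=> [r1 i1]; split.
  by move: r1; congr bmeas; apply/funext => x; case: (H x).
by have := bmeasN i1; congr bmeas; apply/funext => x; case: (H x).
Qed.

Lemma cbmeas_sum (n : nat) (H : 'I_n -> X -> R[i]) : (forall i, cbmeas (H i)) ->
  cbmeas (fun x => \sum_i H i x).
Proof.
elim: n H => [|n IH] H bH; first by under eq_fun do rewrite big_ord0; exact: cbmeas_cst.
under eq_fun do rewrite big_ord_recr/=.
by apply: cbmeasD => //; apply: IH.
Qed.

End Generic.

Lemma cbmeas_comp d d' (X : measurableType d) (Y : measurableType d')
  (H : Y -> R[i]) (u : X -> Y) :
  measurable_fun setT u -> cbmeas H -> cbmeas (fun x => H (u x)).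
Proof.
move=> mu [[m1 [C1 H1]] [m2 [C2 H2]]]; split; split; [|by exists C1| |by exists C2].
  exact: (measurableT_comp m1 mu).
exact: (measurableT_comp m2 mu).
Qed.

Lemma bmeas_integrable (k : R -> R) : bmeas k -> leb.-integrable I01 (EFin \o k).
Proof.
move=> [mk [C kC]]; apply: measurable_bounded_integrable => //.
- by have := @lebesgue_I01 R => /= ->; exact: ltry.
- exact: measurable_funTS.
- exists C; split; first exact: num_real.
  by move=> M CM x _; apply: le_trans (ltW CM).
Qed.

Local Notation "'intI' f" := (\int[leb]_(x in I01) f x) (at level 10, f at level 8).

Lemma le_int_bound (k : R -> R) (C : R) : bmeas k ->
  (forall x, I01 x -> `|k x| <= C) -> `|intI k| <= C.
Proof.
move=> bk kC; have ik := bmeas_integrable bk.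
apply: le_trans; first exact: le_normr_Rintegral.
rewrite [leRHS](_ : _ = intI (fun=> C)); last first.
  by rewrite Rintegral_cst// [X in fine X](@lebesgue_I01 R) mulr1.
apply: le_Rintegral => //.
- exact: integrable_norm.
- by apply: bmeas_integrable; exact: bmeas_cst.
Qed.

(** The theorem on the plane is applied to [k] extended by zero off the unit square; [inner] and
    [inner'] describe the two families of sections. *)
Lemma Fubini_I01 (k : measurableTypeR R * measurableTypeR R -> R) : bmeas k ->
  intI (fun s => intI (fun t => k (s, t))) = intI (fun t => intI (fun s => k (s, t))).
Proof.
move=> [mk [C kC]].
pose mu2 := (leb \x leb)%E.
have mII : measurable (I01 `*` I01) by exact: measurableX.
have ik : mu2.-integrable (I01 `*` I01) (EFin \o k).
  apply: measurable_bounded_integrable => //.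
  - apply: (@le_lt_trans _ _ (leb I01 * leb I01)%E).
      by rewrite le_eqVlt; apply/orP; left; apply/eqP; exact: product_measure1E.
    by rewrite lebesgue_I01 mule1 ltry.
  - exact: measurable_funTS.
  - exists C; split; first exact: num_real.
    by move=> M CM x _; apply: le_trans (ltW CM).
move/integrable_mkcond : ik => /(_ mII) ik.
have := Fubini ik.
have inner (s t : R) : (((EFin \o k) \_ (I01 `*` I01)) (s, t) =
    (if s \in I01 then ((fun t => (k (s, t))%:E) \_ I01) t else 0))%E.
  rewrite /patch; case: (boolP (s \in I01)) => sI; case: (boolP (t \in I01)) => tI //=.
  - by rewrite mem_set//; split => /=; apply/set_mem.
  - by rewrite memNset// => -[/= _ /mem_set]; apply/negP.
  - by rewrite memNset// => -[/= /mem_set sI' _]; rewrite sI' in sI.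
  - by rewrite memNset// => -[/= /mem_set sI' _]; rewrite sI' in sI.
have inner' (s t : R) : (((EFin \o k) \_ (I01 `*` I01)) (s, t) =
    (if t \in I01 then ((fun s => (k (s, t))%:E) \_ I01) s else 0))%E.
  by rewrite inner /patch; case: (s \in I01); case: (t \in I01).
have bs (s : R) : bmeas (fun t => k (s, t)).
  by split; [exact: measurableT_comp|exists C].
have bs' (s : R) : bmeas (fun t : R => k (s, t)) := bs s.
have bt (t : R) : bmeas (fun s => k (s, t)).
  by split; [exact: measurableT_comp|exists C].
have bt' (t : R) : bmeas (fun s : R => k (s, t)) := bt t.
move=> /(congr1 fine); congr (fine _ = fine _).
  rewrite [RHS]integral_mkcond; apply: eq_integral => s _.
  rewrite patchE; under eq_integral do rewrite inner.
  case: ifPn => sI; last by rewrite integral0.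
  rewrite -integral_mkcond /Rintegral fineK//.
  by apply: integrable_fin_num => //; exact: (bmeas_integrable (bs' s)).
rewrite [RHS]integral_mkcond; apply: eq_integral => t _.
rewrite patchE; under eq_integral do rewrite inner'.
case: ifPn => tI; last by rewrite integral0.
rewrite -integral_mkcond /Rintegral fineK//.
by apply: integrable_fin_num => //; exact: (bmeas_integrable (bt' t)).
Qed.

(** Invariance of Haar measure under [x -> y * x^-1]. The substitution gives the integral over
    [[s-1, s]], whose part over [[s-1, 0]] is moved to [[s, 1]] by periodicity. *)
Lemma int_reflect (F : R -> R) (s : R) : continuous F -> (forall x, F (x + 1) = F x) ->
  I01 s -> intI (fun t => F (s - t)) = intI F.
Proof.
move=> cF perF Is; have /andP[s0 s1] : 0 <= s <= 1 by apply/I01P.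
have cFw A : {within A, continuous F} by exact: continuous_subspaceT.
have ic (a b : R) : leb.-integrable `[a, b] (EFin \o F).
  by apply: continuous_compact_integrable => //; exact: segment_compact.
have D1 : derive1 (fun t : R => s - t) = cst (-1).
  by apply/funext => z; rewrite derive1E deriveB// derive_cst derive_id sub0r.
have e1 : (\int[leb]_(x in `[(s - 1)%R, s]) (F x)%:E = \int[leb]_(t in I01) (F (s - t)%R)%:E)%E.
  have := @integration_by_substitution_decreasing R (fun t => s - t) F 0 1 ler01.
  rewrite subr0 D1 => ->.
  - by apply: eq_integral => x _; rewrite /= opprK mulr1.
  - by move=> x y _ _; rewrite ltrD2l ltrN2.
  - by move=> x _; exact: cvg_cst.
  - exact: is_cvg_cst.
  - exact: is_cvg_cst.
  - have cs : continuous (fun t : R => s - t).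
      by move=> t; apply: cvgB; [exact: cvg_cst|exact: cvg_id].
    split.
    + by move=> x _; apply: derivableB.
    + by apply: cvg_at_right_filter; exact: cs.
    + by apply: cvg_at_left_filter; exact: cs.
  - exact: cFw.
have D2 : derive1 (fun t : R => t - 1) = cst 1.
  by apply/funext => z; rewrite derive1E deriveB// derive_cst derive_id subr0.
have e2 : (\int[leb]_(x in `[(s - 1)%R, 0%R]) (F x)%:E = \int[leb]_(x in `[s, 1%R]) (F x)%:E)%E.
  have := @integration_by_substitution_increasing R (fun t => t - 1) F s 1 s1.
  rewrite subrr D2 => ->.
  - by apply: eq_integral => x _; congr EFin; rewrite -[LHS]/(F (x - 1) * 1) mulr1 -perF subrK.
  - by move=> x y _ _; rewrite ltrD2r.
  - by move=> x _; exact: cvg_cst.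
  - exact: is_cvg_cst.
  - exact: is_cvg_cst.
  - have cs : continuous (fun t : R => t - 1).
      by move=> t; apply: cvgB; [exact: cvg_id|exact: cvg_cst].
    split.
    + by move=> x _; apply: derivableB.
    + by apply: cvg_at_right_filter; exact: cs.
    + by apply: cvg_at_left_filter; exact: cs.
  - exact: cFw.
have split_at (a b c : R) : a <= b -> b <= c ->
    \int[leb]_(x in `[a, c]) F x = \int[leb]_(x in `[a, b]) F x + \int[leb]_(x in `[b, c]) F x.
  move=> ab bc; have := @Rintegral_itvB R F (BLeft a) (BRight c) b (ic a c).
  rewrite !bnd_simp => /(_ ab bc) /eqP; rewrite subr_eq => /eqP ->.
  rewrite addrC Rintegral_itv_obnd_cbnd//.
  by apply: (integrableS _ _ _ (ic b c)) => //; exact: subset_itv_oc_cc.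
have -> : intI (fun t => F (s - t)) = \int[leb]_(x in `[s - 1, s]) F x.
  by rewrite /Rintegral e1.
rewrite (split_at _ 0)//; last by rewrite subr_le0.
rewrite [X in X + _](_ : _ = \int[leb]_(x in `[s, 1]) F x); last by rewrite /Rintegral e2.
by rewrite addrC -split_at.
Qed.

End BoundedMeasurable.

(** * Characters of the circle and their integrals *)

Section Circle.
Context {R : realType}.
Local Notation leb := (@lebesgue_measure R).
Local Notation I01 := (@I01 R).
Let mI := @measurable_I01 R.
Local Notation "'intI' f" := (\int[leb]_(x in I01) f x) (at level 10, f at level 8).
Local Notation Re := complex.Re.
Local Notation Im := complex.Im.
Implicit Types (s t : R) (z : int) (H : R -> R[i]).

Lemma circD s t : circ (s + t) = circ s * circ t.
Proof.
rewrite /circ mulrDr cosD sinD; apply/eqP; rewrite eq_complex/=; apply/andP; split => //.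
by rewrite addrC.
Qed.

Lemma circ0 : circ 0 = 1 :> R[i].
Proof. by rewrite /circ mulr0 cos0 sin0. Qed.

Lemma circN t : circ (- t) = (circ t)^*.
Proof. by rewrite /circ mulrN cosN sinN. Qed.

(* Inside a product [_^*] is parsed as [Num.conj]. *)
Lemma conjE (c : R[i]) : Num.conj c = c^*.
Proof. by []. Qed.

Lemma circ_mulJ t : circ t * (circ t)^* = 1.
Proof. by rewrite conjE -circN -circD subrr circ0. Qed.

Lemma norm_circ t : `|circ t| = 1 :> R[i].
Proof. by rewrite normc_def/= cos2Dsin2 sqrtr1. Qed.

Lemma circV t : (circ t)^-1 = circ (- t).
Proof. by rewrite circN invc_norm norm_circ expr1n invr1 mul1r. Qed.

Lemma circX t n : circ t ^+ n = circ (n%:R * t).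
Proof.
elim: n => [|n IH]; first by rewrite mul0r circ0.
by rewrite exprS IH -circD -natr1 mulrDl mul1r addrC.
Qed.

Lemma circXz t z : circ t ^ z = circ (z%:~R * t).
Proof.
case: z => n; first exact: circX.
by rewrite NegzE -exprnN circX circV -mulNr mulrNz.
Qed.

Lemma circ1 : circ 1 = 1 :> R[i].
Proof. by rewrite /circ mulr1 mulr_natl cos2pi sin2pi. Qed.

Lemma circ_int z : circ z%:~R = 1 :> R[i].
Proof. by rewrite -[z%:~R]mulr1 -circXz circ1 exp1rz. Qed.

Lemma circ_half : circ 2^-1 = - 1 :> R[i].
Proof.
rewrite /circ mulrAC divff ?mul1r ?pnatr_eq0// cospi sinpi.
by apply/eqP; rewrite eq_complex/= oppr0 !eqxx.
Qed.

Lemma circ_continuous (c : R) :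
  continuous (fun t => Re (circ (c * t))) /\ continuous (fun t => Im (circ (c * t))).
Proof.
have cl : continuous (fun t => 2 * pi * (c * t)).
  by move=> t; do 2 (apply: cvgM; first exact: cvg_cst); exact: cvg_id.
split => t /=; apply: continuous_comp; do ?exact: cl.
- exact: continuous_cos.
- exact: continuous_sin.
Qed.

Lemma cbmeas_circ (c : R) : cbmeas (fun t : R => circ (c * t)).
Proof.
have [c1 c2] := circ_continuous c.
split; (split; first by exact: continuous_measurable_fun); exists 1 => t.
- exact: cos_max.
- exact: sin_max.
Qed.

Definition cint H : R[i] := (intI (fun t => Re (H t))) +i* (intI (fun t => Im (H t))).

Lemma haar_intE (G : R[i] -> R[i]) : haar_int G = cint (fun t => G (circ t)).
Proof. by []. Qed.

Lemma eq_cint H1 H2 : (forall t, I01 t -> H1 t = H2 t) -> cint H1 = cint H2.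
Proof.
by move=> e; congr (_ +i* _); apply: eq_Rintegral => t /set_mem It; rewrite e.
Qed.

Lemma cintD H1 H2 : cbmeas H1 -> cbmeas H2 ->
  cint (fun t => H1 t + H2 t) = cint H1 + cint H2.
Proof.
move=> [r1 i1] [r2 i2]; rewrite /cint; apply/eqP; rewrite eq_complex/=.
apply/andP; split; apply/eqP; rewrite -RintegralD//; do ?exact: bmeas_integrable.
  by apply: eq_Rintegral => t _; case: (H1 t); case: (H2 t).
by apply: eq_Rintegral => t _; case: (H1 t); case: (H2 t).
Qed.

Lemma intZb (c : R) (k : R -> R) : bmeas k -> intI (fun t => c * k t) = c * intI k.
Proof. by move=> bk; rewrite RintegralZl//; exact: bmeas_integrable. Qed.

Lemma cintZ (c : R[i]) H : cbmeas H -> cint (fun t => c * H t) = c * cint H.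
Proof.
move=> [r i]; have bc := bmeas_cst.
case: c => a b; rewrite /cint; apply/eqP; rewrite eq_complex/=; apply/andP; split; apply/eqP.
  rewrite -!intZb// -RintegralB//; last 2 first.
  - by apply: bmeas_integrable; apply: bmeasM.
  - by apply: bmeas_integrable; apply: bmeasM.
  by apply: eq_Rintegral => t _; case: (H t).
rewrite -!intZb// -RintegralD//; last 2 first.
- by apply: bmeas_integrable; apply: bmeasM.
- by apply: bmeas_integrable; apply: bmeasM.
by apply: eq_Rintegral => t _; case: (H t).
Qed.

Lemma cint0 : cint (fun=> 0) = 0.
Proof. by rewrite /cint/= !Rintegral_cst// !mul0r. Qed.

Lemma cint_sum (n : nat) (H : 'I_n -> R -> R[i]) : (forall i, cbmeas (H i)) ->
  cint (fun t => \sum_i H i t) = \sum_i cint (H i).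
Proof.
elim: n H => [|n IH] H bH.
  by rewrite big_ord0 -[RHS]cint0; apply: eq_cint => t _; rewrite big_ord0.
rewrite big_ord_recr/= -IH// -cintD//; last by apply: cbmeas_sum.
by apply: eq_cint => t _; rewrite big_ord_recr.
Qed.

Lemma cintJ H : cbmeas H -> cint (fun t => (H t)^*) = (cint H)^*.
Proof.
move=> [r i]; rewrite /cint; apply/eqP; rewrite eq_complex/=; apply/andP; split; apply/eqP.
  by apply: eq_Rintegral => t _; case: (H t).
rewrite -mulN1r -intZb//.
by apply: eq_Rintegral => t _; rewrite mulN1r; case: (H t).
Qed.

Lemma cint_reflect H s : continuous (fun t => Re (H t)) -> continuous (fun t => Im (H t)) ->
  (forall t, H (t + 1) = H t) -> I01 s -> cint (fun t => H (s - t)) = cint H.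
Proof.
move=> cr ci per Is; rewrite /cint; congr (_ +i* _).
  by apply: (@int_reflect _ (fun t => Re (H t))) => // x; rewrite per.
by apply: (@int_reflect _ (fun t => Im (H t))) => // x; rewrite per.
Qed.

Lemma cint_Fubini (K : measurableTypeR R * measurableTypeR R -> R[i]) : cbmeas K ->
  cint (fun s => cint (fun t => K (s, t))) = cint (fun t => cint (fun s => K (s, t))).
Proof.
move=> [r i]; have := Fubini_I01 i; have := Fubini_I01 r.
by rewrite /cint/= => -> ->.
Qed.

(* Both reflections [t -> - t] and [t -> 1/(2z) - t] preserve the integral, and the
   second one differs from the first one by the factor [circ (1/2) = - 1]. *)
Lemma cint_circ z : z != 0 -> cint (fun t => circ (z%:~R * t)) = 0.
Proof.
move=> z0; have zR0 : z%:~R != 0 :> R by rewrite intr_eq0.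
wlog zpos : z z0 zR0 / 0 < z.
  move=> W; have [zp|zn|/eqP] := ltgtP z 0; last by rewrite (negbTE z0).
    have := W (- z); rewrite oppr_eq0 oppr_gt0 mulrNz oppr_eq0 => /(_ z0 zR0 zp).
    move=> /(congr1 (fun c => c^*)); rewrite -cintJ; last exact: cbmeas_circ.
    rewrite conjc0 => <-; apply: eq_cint => t _.
    by rewrite -circN mulNr opprK.
  exact: W.
have [c1 c2] := circ_continuous z%:~R.
have per t : circ (z%:~R * (t + 1)) = circ (z%:~R * t) :> R[i].
  by rewrite mulrDr mulr1 circD circ_int mulr1.
have refl s : I01 s -> cint (fun t => circ (z%:~R * t)) =
    circ (z%:~R * s) * cint (fun t => circ (- z%:~R * t)).
  move=> Is; rewrite -(cint_reflect c1 c2 per Is) -cintZ; last exact: cbmeas_circ.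
  by apply: eq_cint => t _; rewrite mulrBr circD mulNr.
have zR1 : 1 <= z%:~R :> R by rewrite ler1z; lia.
have e0 := refl 0; rewrite mulr0 circ0 mul1r I01P lexx ler01 in e0.
have hI : I01 (2 * z%:~R)^-1.
  have z2 : 1 <= 2 * z%:~R :> R by lra.
  have z20 : 0 < 2 * z%:~R :> R by lra.
  apply/I01P; rewrite invr_ge0 (ltW z20)/= -[X in _ <= X]invr1 lef_pV2 ?posrE//.
have := refl _ hI.
have -> : z%:~R * (2 * z%:~R)^-1 = 2^-1 :> R by field.
rewrite circ_half mulN1r -e0// => H.
move: H; case: (cint _) => a b /eqP; rewrite eq_complex/= => /andP[/eqP h1 /eqP h2].
by apply/eqP; rewrite eq_complex/=; apply/andP; split; apply/eqP; lra.
Qed.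

End Circle.

(** * Fejer summation *)

Section Fejer.
Context {R : realType}.
Local Notation leb := (@lebesgue_measure R).
Local Notation I01 := (@I01 R).
Let mI := @measurable_I01 R.
Local Notation "'intI' f" := (\int[leb]_(x in I01) f x) (at level 10, f at level 8).
Local Notation Re := complex.Re.
Local Notation Im := complex.Im.
Implicit Types (s t : R) (z : int) (G : R -> R[i]).

Definition nsq (x : R[i]) : R := Re x ^+ 2 + Im x ^+ 2.

Lemma nsq_ge0 x : 0 <= nsq x.
Proof. by rewrite addr_ge0 ?sqr_ge0. Qed.

Lemma nsqM x y : nsq (x * y) = nsq x * nsq y.
Proof. by case: x => a b; case: y => c d; rewrite /nsq/=; ring. Qed.

Lemma mulJ_nsq (x : R[i]) : x * x^*%C = (nsq x)%:C.
Proof.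
case: x => a b; rewrite /nsq; apply/eqP; rewrite eq_complex/=.
by apply/andP; split; apply/eqP; ring.
Qed.

Lemma nsq_1Bcirc t : nsq (1 - circ t) = 2 - 2 * cos (2 * pi * t).
Proof.
rewrite /nsq/=; have := cos2Dsin2 (2 * pi * t).
by move: (cos _) (sin _) => c d; rewrite sub0r sqrrN; lra.
Qed.

Definition dirichlet n t : R[i] := \sum_(j < n) circ (j%:R * t).

(** As a normalised squared modulus the kernel is visibly non-negative, and expanding the square
    produces the frequencies [k - j] of the Cesaro means. *)
Definition fejer n t : R := n%:R^-1 * nsq (dirichlet n t).

Lemma fejer_ge0 n t : 0 <= fejer n t.
Proof. by rewrite mulr_ge0 ?invr_ge0 ?nsq_ge0. Qed.

Lemma cbmeas_circXz z : cbmeas (fun t => circ t ^ z).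
Proof. by under eq_fun do rewrite circXz; exact: cbmeas_circ. Qed.

Lemma bmeas_fejer n : bmeas (fejer n).
Proof.
have [r i] : cbmeas (dirichlet n) by apply: cbmeas_sum => j; exact: cbmeas_circ.
apply: bmeasM; first exact: bmeas_cst.
by apply: bmeasD; under eq_fun do rewrite expr2; apply: bmeasM.
Qed.

(** Multiplying the geometric sum by [1 - circ t] gives [1 - circ (n t)], whose squared modulus is
    at most 4, while that of [1 - circ t] is at least [c]. *)
Lemma fejer_bound n t (c : R) : 0 < c -> c <= 2 - 2 * cos (2 * pi * t) ->
  fejer n t <= n%:R^-1 * (4 / c).
Proof.
move=> c0 ct; rewrite /fejer ler_wpM2l ?invr_ge0// ler_pdivlMr//.
apply: (@le_trans _ _ (nsq (dirichlet n t) * nsq (1 - circ t))).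
  by rewrite ler_wpM2l ?nsq_ge0// nsq_1Bcirc.
rewrite -nsqM mulrC.
have -> : (1 - circ t) * dirichlet n t = 1 - circ (n%:R * t).
  rewrite -circX -opprB mulNr; rewrite -[RHS]opprB; congr (- _).
  by rewrite subrX1; congr (_ * _); apply: eq_bigr => j _; rewrite circX.
rewrite nsq_1Bcirc; have := cos_geN1 (2 * pi * (n%:R * t)); lra.
Qed.

Lemma cint_fejer n G : cbmeas G ->
  cint (fun t => G t * (fejer n t)%:C) =
  n%:R^-1%:C * \sum_(j < n) \sum_(k < n) cint (fun t => G t * (circ t ^ (k%:Z - j%:Z))^*).
Proof.
move=> bG.
have bterm (j k : 'I_n) : cbmeas (fun t => G t * (circ t ^ (k%:Z - j%:Z))^*%C).
  by apply: cbmeasM => //; apply: cbmeasJ; exact: cbmeas_circXz.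
have e t : G t * (fejer n t)%:C = n%:R^-1%:C *
    \sum_(j < n) \sum_(k < n) (G t * (circ t ^ (k%:Z - j%:Z))^*%C).
  rewrite /fejer rmorphM/= -mulJ_nsq mulrCA; congr (_ * _).
  rewrite /dirichlet (raddf_sum (@conjc R)) mulr_suml mulr_sumr; apply: eq_bigr => j _.
  rewrite mulr_sumr mulr_sumr; apply: eq_bigr => k _; congr (_ * _).
  transitivity (circ (j%:R * t) * circ (- (k%:R * t))); first by rewrite circN.
  rewrite -circD circXz -circN; congr circ.
  by rewrite intrB -!pmulrn mulrBl opprB.
rewrite (eq_cint (H2 := fun t => n%:R^-1%:C *
    \sum_(j < n) \sum_(k < n) (G t * (circ t ^ (k%:Z - j%:Z))^*%C)))//.
rewrite cintZ; last by apply: cbmeas_sum => j; exact: cbmeas_sum.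
congr (_ * _); rewrite cint_sum; last by move=> j; exact: cbmeas_sum.
by apply: eq_bigr => j _; rewrite cint_sum.
Qed.

Lemma cint_circXz z : cint (fun t => circ t ^ z) = (z == 0)%:R.
Proof.
case: eqP => [->|/eqP z0].
  rewrite (eq_cint (H2 := fun=> 1))//.
  by rewrite /cint/= !Rintegral_cst// [X in fine X](@lebesgue_I01 R) mulr1 mul0r.
by rewrite mulr0n -(cint_circ z0); apply: eq_cint => t _; rewrite circXz.
Qed.

Lemma int_fejer n : intI (fejer n.+1) = 1.
Proof.
have := @cint_fejer n.+1 (fun=> 1) (cbmeas_cst _ _).
rewrite (eq_bigr (fun=> 1)) => [|j _]; last first.
  rewrite (bigD1 j)//= big1 ?addr0 => [|k kj].
    rewrite (eq_cint (H2 := fun t => circ t ^ 0)) ?cint_circXz ?eqxx// => t _.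
    by rewrite subrr mul1r conjE conjc1.
  rewrite (eq_cint (H2 := fun t => (circ t ^ (k%:Z - j%:Z))^*%C)); last first.
    by move=> t _; rewrite mul1r.
  rewrite cintJ; last exact: cbmeas_circXz.
  rewrite cint_circXz subr_eq0 eqz_nat (negbTE (_ : k != j :> nat)) ?conjc0//.
rewrite sumr_const card_ord -[X in _ * X]/(n.+1%:R).
have -> : n.+1%:R = (n.+1%:R : R)%:C by rewrite rmorph_nat.
rewrite -rmorphM/= mulVf ?pnatr_eq0// => /(congr1 (@complex.Re R))/= <-.
by apply: eq_Rintegral => t _; rewrite mul1r mulr0 subr0.
Qed.

(** The kernel is an approximate identity. The point 1 of the circle is seen from both ends of
    [0,1], hence three zones: near 0 and near 1 continuity is used, in the middle the kernel is
    [O(1/n)]. *)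
Lemma fejer_cvg (P : R -> R) : bmeas P -> continuous P -> (forall t, P (t + 1) = P t) ->
  (fun n => intI (fun t => P t * fejer n.+1 t)) @ \oo --> P 0.
Proof.
move=> bP cP perP; have [_ [S PS]] := bP.
apply/cvgrPdist_lt => e e0.
have e20 : 0 < e / 2 by rewrite divr_gt0.
have /cvgrPdist_lt /(_ _ e20) [d /= d0 Hd] := cP 0.
(* The bound 1/4 keeps [2 pi d'] inside [[0, pi]], where cosine is strictly decreasing. *)
pose d' := Num.min (d / 2) 4^-1.
have d'0 : 0 < d' by rewrite lt_min divr_gt0//= invr_gt0.
have d'd : d' < d by rewrite gt_min; apply/orP; left; lra.
have d'4 : d' <= 4^-1 by rewrite ge_min lexx orbT.
have near0 t : `|t| <= d' -> `|P t - P 0| <= e / 2.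
  move=> td; rewrite distrC ltW//; apply: Hd => /=.
  by rewrite sub0r normrN (le_lt_trans td).
(* This is the squared modulus of [1 - circ d'], the least value of that of [1 - circ t] for [t] in
   [[d', 1 - d']]. *)
pose c := 2 - 2 * cos (2 * pi * d').
have pi0 := @pi_gt0 R.
have in0pi (u : R) : 0 <= u <= 2^-1 -> 2 * pi * u \in `[0, pi].
  by move=> /andP[u0 u1]; rewrite in_itv/=; apply/andP; split; nra.
have c0 : 0 < c.
  suff : cos (2 * pi * d') < 1 by rewrite /c; lra.
  have h0 : 0 \in `[0, @pi R] by rewrite in_itv/= lexx ltW.
  have h1 : 2 * pi * d' \in `[0, pi] by apply: in0pi; apply/andP; split; lra.
  by rewrite -[X in _ < X](@cos0 R) (ltr_cos h0 h1) !mulr_gt0.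
have cmid t : d' <= t <= 1 - d' -> c <= 2 - 2 * cos (2 * pi * t).
  move=> /andP[t1 t2].
  have half (u : R) : d' <= u <= 2^-1 -> cos (2 * pi * u) <= cos (2 * pi * d').
    move=> /andP[u1 u2]; move: u1; rewrite le_eqVlt => /predU1P[->//|u1].
    rewrite ltW// ltr_cos ?in0pi//; [|by apply/andP; split; lra..].
    by rewrite ltr_pM2l// mulr_gt0.
  have [t3|t3] := leP t 2^-1; first by have := half t; rewrite t1 t3 => /(_ isT); rewrite /c; lra.
  have -> : cos (2 * pi * t) = cos (2 * pi * (1 - t)).
    have -> : 2 * pi * (1 - t) = - (2 * pi * t) + pi *+ 2 by rewrite mulr2n; ring.
    by rewrite cosD2pi cosN.
  by have := half (1 - t); rewrite /c => H; have {}H := H _; lra.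
have key n t : I01 t -> `|(P t - P 0) * fejer n.+1 t| <=
    e / 2 * fejer n.+1 t + 2 * S * (n.+1%:R^-1 * (4 / c)).
  move=> /I01P/andP[t0 t1]; rewrite normrM (ger0_norm (fejer_ge0 _ _)).
  have S0 : 0 <= S by apply: le_trans (PS 0).
  have f0 := fejer_ge0 n.+1 t.
  have rest : 0 <= 2 * S * (n.+1%:R^-1 * (4 / c)).
    by rewrite !mulr_ge0// ?invr_ge0// ltW.
  have [t2|t2] := leP t d'.
    have h1 : `|P t - P 0| <= e / 2 by apply: near0; rewrite ger0_norm.
    by rewrite -[X in X <= _]addr0 lerD// ler_wpM2r.
  have [t3|t3] := leP t (1 - d').
    have h1 : `|P t - P 0| <= 2 * S.
      by rewrite (le_trans (ler_normB _ _))// mulr2n mulrDl mul1r lerD.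
    rewrite -[X in X <= _]add0r; apply: lerD; first by apply: mulr_ge0 => //; exact: ltW.
    by apply: ler_pM => //; apply: fejer_bound => //; apply: cmid; rewrite (ltW t2).
  have h1 : `|P t - P 0| <= e / 2.
    rewrite -(subrK 1 t) perP; apply: near0; rewrite ler0_norm ?subr_le0//; lra.
  by rewrite -[X in X <= _]addr0 lerD// ler_wpM2r.
have bF n := bmeas_fejer n.
have bPF n : bmeas (fun t => (P t - P 0) * fejer n t).
  by apply: bmeasM => //; apply: bmeasB => //; exact: bmeas_cst.
have bound n : `|P 0 - intI (fun t => P t * fejer n.+1 t)| <=
    e / 2 + 2 * S * (n.+1%:R^-1 * (4 / c)).
  have -> : P 0 - intI (fun t => P t * fejer n.+1 t) =
      - intI (fun t => (P t - P 0) * fejer n.+1 t).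
    rewrite -[X in X - _]mulr1 -(int_fejer n) -intZb// -opprB; congr (- _).
    rewrite -RintegralB//; last 2 first.
    - by apply: bmeas_integrable; apply: bmeasM.
    - by apply: bmeas_integrable; apply: bmeasM => //; exact: bmeas_cst.
    by apply: eq_Rintegral => t _; rewrite mulrBl.
  rewrite normrN; apply: le_trans.
    by apply: le_normr_Rintegral => //; exact: bmeas_integrable.
  have -> : e / 2 + 2 * S * (n.+1%:R^-1 * (4 / c)) =
      intI (fun t => e / 2 * fejer n.+1 t + 2 * S * (n.+1%:R^-1 * (4 / c))).
    rewrite RintegralD//; last 2 first.
    - by apply: bmeas_integrable; apply: bmeasM => //; exact: bmeas_cst.
    - by apply: bmeas_integrable; exact: bmeas_cst.
    by rewrite intZb// int_fejer mulr1 Rintegral_cst// [X in fine X](@lebesgue_I01 R) mulr1.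
  apply: le_Rintegral => //.
  - by apply: integrable_norm; exact: bmeas_integrable.
  - apply: bmeas_integrable; apply: bmeasD; last exact: bmeas_cst.
    by apply: bmeasM => //; exact: bmeas_cst.
  - by move=> t It; exact: key.
have : (fun n => 2 * S * (n.+1%:R^-1 * (4 / c))) @ \oo --> 2 * S * (0 * (4 / c)).
  by apply: cvgM; [exact: cvg_cst|apply: cvgM; [exact: cvg_harmonic|exact: cvg_cst]].
rewrite mul0r mulr0 => /cvgrPdist_lt /(_ _ e20); apply: filterS => n.
rewrite sub0r normrN => h1; apply: (le_lt_trans (bound n)).
by rewrite [ltRHS](splitr e) ltrD2l (le_lt_trans (ler_norm _)).
Qed.

(* [S_n] are the symmetric partial sums and [A_n] their Cesaro means, written as
   averages over the square: the inner sums are at most [S_n], and all but [2 M] of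
   them are at least [S_M]. *)
Lemma symmetric_sums_cvg (al : int -> R) (p : R) : (forall z, 0 <= al z) ->
  (fun n => n.+1%:R^-1 * \sum_(j < n.+1) \sum_(k < n.+1) al (k%:Z - j%:Z)) @ \oo --> p ->
  (forall n, \sum_(i < n.*2.+1) al (i%:Z - n%:Z) <= p) /\
  (fun n => \sum_(i < n.*2.+1) al (i%:Z - n%:Z)) @ \oo --> p.
Proof.
move=> al0 Ap.
have window (F : nat -> R) m c n : (forall i, 0 <= F i) -> (m + c <= n)%N ->
    \sum_(k < m) F (c + k)%N <= \sum_(i < n) F i.
  move=> F0 mcn; suff {mcn} : forall d, \sum_(k < m) F (c + k)%N <= \sum_(i < c + (m + d)) F i.
    move=> /(_ (n - (m + c))%N).
    by have -> : (c + (m + (n - (m + c))) = n)%N by lia.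
  move=> d; rewrite big_split_ord/= -[leLHS]add0r lerD ?sumr_ge0//.
  by rewrite big_split_ord/= lerDl sumr_ge0.
have lower M : \sum_(i < M.*2.+1) al (i%:Z - M%:Z) <= p.
  set SM := \sum_(i < _) _.
  have SM0 : 0 <= SM by apply: sumr_ge0.
  have lim1 : (fun n : nat => n.+1%:R / (n.+1 + M.*2)%:R * SM) @ \oo --> SM.
    have -> : (fun n : nat => n.+1%:R / (n.+1 + M.*2)%:R * SM) =
        (fun n : nat => SM - M.*2%:R / (n.+1 + M.*2)%:R * SM).
      apply/funext => n; have n0 : (n.+1 + M.*2)%:R != 0 :> R by rewrite pnatr_eq0; lia.
      rewrite -{2}[SM]mul1r -mulrBl; congr (_ * _); apply: (mulIf n0).
      by rewrite mulrBl !divfK// mul1r natrD addrK.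
    rewrite -[X in _ --> X]subr0; apply: cvgB; first exact: cvg_cst.
    rewrite -[X in _ --> X](mul0r SM); apply: cvgM; last exact: cvg_cst.
    apply: norm_cvg0; apply: (@squeeze_cvgr _ _ _ _ (fun=> 0) (fun n => M.*2%:R * harmonic n)).
    - apply: nearW => n; rewrite normr_ge0/= ger0_norm ?divr_ge0// ler_wpM2l//.
      by rewrite /harmonic lef_pV2 ?posrE ?ltr0n ?ler_nat//; lia.
    - exact: cvg_cst.
    - by rewrite -[X in _ --> X](mulr0 M.*2%:R); apply: cvgM; [exact: cvg_cst|exact: cvg_harmonic].
  have lim2 : (fun n => (n + M.*2).+1%:R^-1 * \sum_(j < (n + M.*2).+1)
      \sum_(k < (n + M.*2).+1) al (k%:Z - j%:Z)) @ \oo --> p.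
    by move: Ap; rewrite -(cvg_shiftn M.*2).
  apply: (ler_cvg_to lim1 lim2); apply: nearW => n.
  rewrite mulrAC mulrC -addSn ler_wpM2l ?invr_ge0//.
  (* Only the middle centres [M + j] with [j <= n] are kept: for them [k - (M + j)] runs over all of
     [[-M, M]]. *)
  apply: (@le_trans _ _ (\sum_(j < n.+1) \sum_(k < n.+1 + M.*2) al (k%:Z - (M + j)%N%:Z))).
    have -> : n.+1%:R * SM = \sum_(j < n.+1) SM by rewrite sumr_const card_ord mulr_natl.
    apply: ler_sum => j _.
    have W : (M.*2.+1 + j <= n.+1 + M.*2)%N by have := ltn_ord j; lia.
    apply: le_trans (@window (fun k => al (k%:Z - (M + j)%N%:Z)) _ j _ (fun _ => al0 _) W).
    by rewrite le_eqVlt; apply/orP; left; apply/eqP; apply: eq_bigr => i _; congr al; lia.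
  apply: (@window (fun j => \sum_(k < n.+1 + M.*2) al (k%:Z - j%:Z))); last by lia.
  by move=> i; apply: sumr_ge0.
split => //.
apply: (@squeeze_cvgr _ _ _ _
  (fun n => n.+1%:R^-1 * \sum_(j < n.+1) \sum_(k < n.+1) al (k%:Z - j%:Z)) (fun=> p)) => //.
  apply: nearW => n; rewrite lower andbT mulrC ler_pdivrMr// mulrC.
  set Sn := \sum_(i < n.*2.+1) _.
  have -> : n.+1%:R * Sn = \sum_(j < n.+1) Sn by rewrite sumr_const card_ord mulr_natl.
  apply: ler_sum => j _; have jn := ltn_ord j.
  have W : (n.+1 + (n - j) <= n.*2.+1)%N by lia.
  apply: le_trans (@window (fun i => al (i%:Z - n%:Z)) _ (n - j)%N _ (fun _ => al0 _) W).
  by rewrite le_eqVlt; apply/orP; left; apply/eqP; apply: eq_bigr => i _; congr al; lia.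
exact: cvg_cst.
Qed.

End Fejer.

(** * Fourier coefficients of [l * ~l] *)

Section ConvTilde.
Context {R : realType}.
Local Notation leb := (@lebesgue_measure R).
Local Notation I01 := (@I01 R).
Let mI := @measurable_I01 R.
Local Notation "'intI' f" := (\int[leb]_(x in I01) f x) (at level 10, f at level 8).
Local Notation Re := complex.Re.
Local Notation Im := complex.Im.
Implicit Types (s t : R) (z : int).

Variable l : R[i] -> R[i].
Hypothesis cl : continuous_on_circle l.
Let L t := l (circ t).

Let cRe : continuous (fun t => Re (L t)). Proof. by case: cl. Qed.
Let cIm : continuous (fun t => Im (L t)). Proof. by case: cl. Qed.

Let circ_mod t : circ (t - (Num.floor t)%:~R) = circ t :> R[i].
Proof. by rewrite circD -mulrNz circ_int mulr1. Qed.

Lemma bounded_on_circle (k : R[i] -> R) : continuous (fun t => k (circ t)) ->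
  exists C, forall t, `|k (circ t)| <= C.
Proof.
move=> ck; have I0 : I01 0 by rewrite I01P lexx ler01.
have ck' : {within I01, continuous (fun t => `|k (circ t)|)}.
  by apply: continuous_subspaceT => t; apply: continuous_comp; [exact: ck|exact: norm_continuous].
have [//|c _ Hc] := compact_EVT_max _ (@segment_compact R 0 1) ck'; first by exists 0.
exists `|k (circ c)| => t; rewrite -circ_mod; apply: Hc.
apply/mem_set/I01P; rewrite subr_ge0 floor_le_tmp/=.
by have := floorD1_gt t; rewrite intrD mulr1z; lra.
Qed.

Lemma cbmeas_circle : cbmeas L.
Proof.
split; (split; first exact: continuous_measurable_fun).
- by have [C HC] := bounded_on_circle (k := fun x => Re (l x)) cRe; exists C.
- by have [C HC] := bounded_on_circle (k := fun x => Im (l x)) cIm; exists C.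
Qed.

Let F t := conv_tilde l (circ t).

Lemma conv_tildeE t : F t = cint (fun s => L s * (L (s - t))^*).
Proof.
rewrite /F /conv_tilde haar_intE; apply: eq_cint => s _.
by rewrite /L circV -circD addrC.
Qed.

Lemma conv_tilde_per t : F (t + 1) = F t.
Proof. by rewrite /F circD circ1 mulr1. Qed.

Lemma measurable_fun_sub t : measurable_fun setT (fun s : R => s - t).
Proof.
apply: continuous_measurable_fun => s.
by apply: cvgB; [exact: cvg_id|exact: cvg_cst].
Qed.

Lemma cbmeas_shift t : cbmeas (fun s => L (s - t)).
Proof. exact: cbmeas_comp (measurable_fun_sub t) cbmeas_circle. Qed.

Lemma continuous_int (k : R -> R -> R) (C : R) : (forall t, bmeas (k t)) ->
  (forall s, continuous (k^~ s)) -> (forall t s, `|k t s| <= C) ->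
  continuous (fun t => intI (k t)).
Proof.
move=> bk ck kC t.
have := @continuity_under_integral R _ _ leb k I01 mI (t - 1) (t + 1) _ _ (fun=> C) _ _ t.
apply.
- by move=> u _; exact: bmeas_integrable.
- by apply: aeW => s _ u _; exact: ck.
- by apply: bmeas_integrable; exact: bmeas_cst.
- by move=> u _; apply: aeW => s _; exact: kC.
- by rewrite inE /= in_itv/=; apply/andP; split; lra.
Qed.

Lemma continuous_conv_tilde : continuous (fun t => Re (F t)) /\ continuous (fun t => Im (F t)).
Proof.
have [[mr [C1 H1]] [mi [C2 H2]]] := cbmeas_circle.
have bK t : cbmeas (fun s => L s * (L (s - t))^*%C).
  by apply: cbmeasM; [exact: cbmeas_circle|apply: cbmeasJ; exact: cbmeas_shift].
have csh (G : R -> R) s : continuous G -> continuous (fun t => G (s - t)).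
  move=> cG t; apply: continuous_comp; last exact: cG.
  by apply: cvgB; [exact: cvg_cst|exact: cvg_id].
have C10 : 0 <= C1 by apply: le_trans (H1 0).
have C20 : 0 <= C2 by apply: le_trans (H2 0).
pose C := C1 * C1 + C2 * C2 + 2 * (C1 * C2).
have cM (c : R) (G : R -> R) : continuous G -> continuous (fun t => c * G t).
  by move=> cG t; apply: cvgM; [exact: cvg_cst|exact: cG].
have M1 s t : `|Re (L s) * Re (L t)| <= C1 * C1 by rewrite normrM ler_pM.
have M2 s t : `|Im (L s) * Im (L t)| <= C2 * C2 by rewrite normrM ler_pM.
have M3 s t : `|Re (L s) * Im (L t)| <= C1 * C2 by rewrite normrM ler_pM.
have M4 s t : `|Im (L s) * Re (L t)| <= C1 * C2 by rewrite mulrC M3.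
have P12 : 0 <= C1 * C2 by rewrite mulr_ge0.
split.
  have -> : (fun t => Re (F t)) = (fun t => intI (fun s => Re (L s * (L (s - t))^*%C))).
    by apply/funext => t; rewrite conv_tildeE.
  apply: (@continuous_int _ C) => [t|s|t s]; first by case: (bK t).
    have -> : (fun t => Re (L s * (L (s - t))^*%C)) =
        (fun t => Re (L s) * Re (L (s - t)) + Im (L s) * Im (L (s - t))).
      by apply/funext => t; case: (L s) => a b; case: (L (s - t)) => c d /=; ring.
    by move=> t; apply: cvgD; apply: cM; apply: (@csh (fun t => _ (L t))).
  have -> : Re (L s * (L (s - t))^*%C) = Re (L s) * Re (L (s - t)) + Im (L s) * Im (L (s - t)).
    by case: (L s) => a b; case: (L (s - t)) => c d /=; ring.
  rewrite (le_trans (ler_normD _ _))//.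
  by have := M1 s (s - t); have := M2 s (s - t); rewrite /C; lra.
have -> : (fun t => Im (F t)) = (fun t => intI (fun s => Im (L s * (L (s - t))^*%C))).
  by apply/funext => t; rewrite conv_tildeE.
apply: (@continuous_int _ C) => [t|s|t s]; first by case: (bK t).
  have -> : (fun t => Im (L s * (L (s - t))^*%C)) =
      (fun t => Im (L s) * Re (L (s - t)) - Re (L s) * Im (L (s - t))).
    by apply/funext => t; case: (L s) => a b; case: (L (s - t)) => c d /=; ring.
  by move=> t; apply: cvgB; apply: cM; apply: (@csh (fun t => _ (L t))).
have -> : Im (L s * (L (s - t))^*%C) = Im (L s) * Re (L (s - t)) - Re (L s) * Im (L (s - t)).
  by case: (L s) => a b; case: (L (s - t)) => c d /=; ring.
rewrite (le_trans (ler_normB _ _))//.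
have := M3 s (s - t); have := M4 s (s - t); have := M1 0 0; have := M2 0 0.
have := normr_ge0 (Re (L 0) * Re (L 0)); have := normr_ge0 (Im (L 0) * Im (L 0)).
rewrite /C; lra.
Qed.

Lemma cbmeas_conv_tilde : cbmeas F.
Proof.
have [c1 c2] := continuous_conv_tilde.
split; (split; first exact: continuous_measurable_fun).
- by have [C HC] := bounded_on_circle (k := fun x => Re (conv_tilde l x)) c1; exists C.
- by have [C HC] := bounded_on_circle (k := fun x => Im (conv_tilde l x)) c2; exists C.
Qed.

(** Splitting the character as [(e t)^* = (e s)^* e (s - t)] turns the double integrand into
    [c s * G (s - t)]. After exchanging the integrals, reflection invariance separates the two
    factors, which are conjugate to each other. *)
Lemma fourier_conv_tilde z :
  fourier (conv_tilde l) z = (nsq (cint (fun t => L t * (circ (z%:~R * t))^*)))%:C.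
Proof.
pose e t : R[i] := circ (z%:~R * t).
have ce : cbmeas e by exact: cbmeas_circ.
have [ce1 ce2] := circ_continuous (R := R) z%:~R.
have bL := cbmeas_circle.
pose G t := (L t)^*%C * e t.
have bG : cbmeas G by apply: cbmeasM => //; exact: cbmeasJ.
pose c s := L s * (e s)^*%C.
have bc : cbmeas c by apply: cbmeasM => //; exact: cbmeasJ.
have perG t : G (t + 1) = G t.
  by rewrite /G /L /e circD circ1 mulr1 mulrDr mulr1 circD circ_int mulr1.
have cG1 : continuous (fun t => Re (G t)).
  have -> : (fun t => Re (G t)) = (fun t => Re (L t) * Re (e t) + Im (L t) * Im (e t)).
    by apply/funext => t; rewrite /G; case: (L t) => a b; case: (e t) => u v /=; ring.
  by move=> t; apply: cvgD; apply: cvgM; do ?[exact: cRe|exact: cIm|exact: ce1|exact: ce2].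
have cG2 : continuous (fun t => Im (G t)).
  have -> : (fun t => Im (G t)) = (fun t => Re (L t) * Im (e t) - Im (L t) * Re (e t)).
    by apply/funext => t; rewrite /G; case: (L t) => a b; case: (e t) => u v /=; ring.
  by move=> t; apply: cvgB; apply: cvgM; do ?[exact: cRe|exact: cIm|exact: ce1|exact: ce2].
have eJ s t : (e t)^*%C = (e s)^*%C * e (s - t).
  have h := circ_mulJ (z%:~R * s); rewrite conjE in h.
  by rewrite /e mulrBr circD circN mulrCA mulrA h mul1r.
pose K (st : measurableTypeR R * measurableTypeR R) := c st.1 * G (st.1 - st.2).
have bK : cbmeas K.
  apply: cbmeasM; first by apply: (cbmeas_comp (H := c) (u := fst)).
  apply: (cbmeas_comp (H := G)
    (u := fun st : measurableTypeR R * measurableTypeR R => st.1 - st.2 : R)) => //.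
  by apply: measurable_funB; [exact: measurable_fst|exact: measurable_snd].
rewrite -mulJ_nsq.
transitivity (cint (fun t => cint (fun s => K (s, t)))).
  rewrite /fourier haar_intE; apply: eq_cint => t _.
  rewrite conjE circXz -/(e t) -/(F t) conv_tildeE mulrC -cintZ; last first.
    apply: cbmeasM => //; apply: cbmeasJ; exact: cbmeas_shift.
  apply: eq_cint => s _; rewrite (eJ s t) conjE -[RHS]/(c s * G (s - t)) /c /G.
  by ring.
rewrite -cint_Fubini// (eq_cint (H2 := fun s => cint G * c s)).
  rewrite cintZ// mulrC; congr (_ * _).
  rewrite -cintJ//; apply: eq_cint => t _.
  rewrite conjE -/(e t) /G; case: (L t) => a b; case: (e t) => u v.
  by apply/eqP; rewrite eq_complex/=; apply/andP; split; apply/eqP; ring.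
move=> s Is; rewrite /K/= cintZ; last first.
  apply: cbmeas_comp bG; apply: continuous_measurable_fun => t.
  by apply: cvgB; [exact: cvg_cst|exact: cvg_id].
by rewrite cint_reflect// mulrC.
Qed.

Definition power z : R := nsq (cint (fun t => L t * (circ (z%:~R * t))^*)).

Lemma power_ge0 z : 0 <= power z.
Proof. exact: nsq_ge0. Qed.

(** The value at 1 is the integral of [|l|^2]. *)
Lemma conv_tilde1 : conv_tilde l 1 = (Re (conv_tilde l 1))%:C.
Proof.
have -> : conv_tilde l 1 = F 0 by rewrite /F circ0.
rewrite conv_tildeE; apply/eqP; rewrite eq_complex/= eqxx/=; apply/eqP.
transitivity (intI (fun _ : R => 0)); last by rewrite Rintegral_cst ?mul0r.
by apply: eq_Rintegral => s _; rewrite subr0 conjE mulJ_nsq.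
Qed.

(** Parseval's identity for [l]: the averages of [power (k - j)] are the Fejer means of [l * ~l] at
    1. *)
Lemma power_sum_cvg :
  (forall n, \sum_(i < n.*2.+1) power (i%:Z - n%:Z) <= Re (conv_tilde l 1)) /\
  (fun n => \sum_(i < n.*2.+1) power (i%:Z - n%:Z)) @ \oo --> Re (conv_tilde l 1).
Proof.
have [c1 _] := continuous_conv_tilde; have bF := cbmeas_conv_tilde.
apply: symmetric_sums_cvg => [z|]; first exact: power_ge0.
have := fejer_cvg bF.1 c1.
have -> : Re (conv_tilde l 1) = Re (F 0) by rewrite /F circ0.
move=> H; have {}H := H (fun t => congr1 (@complex.Re R) (conv_tilde_per t)).
suff -> : (fun n : nat => n.+1%:R^-1 * \sum_(j < n.+1) \sum_(k < n.+1) power (k%:Z - j%:Z)) =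
    (fun n => intI (fun t => Re (F t) * fejer n.+1 t)) by exact: H.
apply/funext => n; have := cint_fejer n.+1 bF => /(congr1 (@complex.Re R)).
rewrite (eq_bigr (fun j : 'I_n.+1 => (\sum_(k < n.+1) power (k%:Z - j%:Z))%:C)); last first.
  move=> j _; rewrite rmorph_sum/=; apply: eq_bigr => k _.
  exact: fourier_conv_tilde.
rewrite -rmorph_sum -rmorphM/= => <-.
by apply: eq_Rintegral => t _; case: (F t) => a b /=; rewrite mulr0 subr0.
Qed.

End ConvTilde.

(** * Diffraction *)

Section SymmetricSums.

Lemma symmetric_sumE (V : nmodType) (F : int -> V) N :
  \sum_(i < N.*2.+1) F (i%:Z - N%:Z) =
  F 0 + \sum_(k < N) (F k.+1%:Z + F (- k.+1%:Z)).
Proof.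
elim: N => [|N IH]; first by rewrite big_ord_recl !big_ord0 subrr.
rewrite [in RHS]big_ord_recr/= addrA -IH doubleS big_ord_recr/= big_ord_recl/=.
have -> : (N.*2.+2%:Z - N.+1%:Z) = N.+1%:Z by lia.
rewrite add0r [F _ + _ in LHS]addrC -addrA [F (- _) + F _]addrC; congr (_ + _).
by apply: eq_bigr => i _; congr F; rewrite /bump/=; lia.
Qed.

Lemma symmetric_sumN (V : nmodType) (F : int -> V) N :
  \sum_(i < N.*2.+1) F (- (i%:Z - N%:Z)) = \sum_(i < N.*2.+1) F (i%:Z - N%:Z).
Proof.
rewrite (symmetric_sumE (fun z => F (- z))) symmetric_sumE oppr0; congr (_ + _).
by apply: eq_bigr => k _; rewrite opprK addrC.
Qed.

End SymmetricSums.

(** * The density [g] and the pairing with test functions *)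

Section Diffraction.
Context {R : realType}.
Local Notation leb := (@lebesgue_measure R).
Local Notation I01 := (@I01 R).
Let mI := @measurable_I01 R.
Local Notation "'intI' f" := (\int[leb]_(x in I01) f x) (at level 10, f at level 8).
Local Notation Re := complex.Re.
Local Notation Im := complex.Im.
Variables (c : int -> R) (D q : R).
Hypothesis q01 : 0 < q < 1.
Hypothesis D0 : 0 <= D.
Hypothesis c_decay : forall z : int, `|c z| <= D * q ^+ `|z|.
Hypothesis cN : forall z, c (- z) = c z.
Implicit Types (x : R[i]) (z : int).

Let q0 : 0 < q. Proof. by case/andP: q01. Qed.
Let q1 : 0 < 1 - q. Proof. by rewrite subr_gt0; case/andP: q01. Qed.

Lemma norm_realC (r : R) : `|r%:C| = `|r|%:C.
Proof. by rewrite normc_def/= expr0n addr0 sqrtr_sqr. Qed.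

Lemma norm_exprz x z : on_circle x -> `|x ^ z| = 1.
Proof.
rewrite /on_circle => x1; case: z => n; first by rewrite normrX x1 expr1n.
by rewrite NegzE -exprnN normfV normrX x1 expr1n invr1.
Qed.

Lemma exprz_JN x z : on_circle x -> x ^ (- z) = (x ^ z)^*.
Proof. by move=> x1; rewrite -invr_expz invc_norm norm_exprz// expr1n invr1 mul1r. Qed.

Lemma norm_Re_exprz x z : on_circle x -> `|Re (x ^ z)| <= 1.
Proof. by move=> x1; rewrite -lecR (le_trans (normc_ge_Re _))// norm_exprz. Qed.

Lemma geometric_sum_le m n : \sum_(m <= k < n) q ^+ k <= q ^+ m / (1 - q).
Proof.
have [mn|nm] := leqP m n; last first.
  by rewrite (big_geq (ltnW nm)); apply: divr_ge0; [exact/exprn_ge0/ltW|exact: ltW].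
suff -> : \sum_(m <= k < n) q ^+ k = (q ^+ m - q ^+ n) / (1 - q).
  by rewrite ler_pM2r ?invr_gt0// gerBl exprn_ge0// ltW.
rewrite (@telescope_sumr_eq _ _ _ (fun k => - (q ^+ k / (1 - q))))//; first by ring.
by move=> k _; rewrite exprS; field; rewrite gt_eqF.
Qed.

(** As [c] is even, the indices [k] and [-k] together contribute [c_k/2 * (x^k + x^-k)], which is
    real, so [g] is obtained from a real one-sided series. The range [|z| <= N] corresponds to the
    [N + 1] terms [k = 0, ..., N]. *)
Definition diffraction_term x (k : nat) : R :=
  if k is 0%N then c 0 / 2 else c k%:Z * Re (x ^ k%:Z).

Lemma zpsum_diffraction x N : on_circle x ->
  zpsum (fun z => ((c z) / 2)%:C * x ^ z) N = (series (diffraction_term x) N.+1)%:C.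
Proof.
move=> x1; rewrite /zpsum (symmetric_sumE (fun z => ((c z) / 2)%:C * x ^ z)).
rewrite /series/= big_nat_recl//= rmorphD/= expr0z mulr1; congr (_ + _).
rewrite big_mkord rmorph_sum/=; apply: eq_bigr => k _.
rewrite cN exprz_JN// -mulrDr; have := addcJ (x ^ k.+1%:Z) => ->.
by rewrite mulrA; apply/eqP; rewrite eq_complex/=; apply/andP; split; apply/eqP; field.
Qed.

Lemma diffraction_term_le x k : on_circle x -> `|diffraction_term x k| <= D * q ^+ k.
Proof.
move=> x1; case: k => [|k] /=.
  have := c_decay 0; rewrite absz0 normrM [`|2^-1|]ger0_norm// => h.
  by rewrite (le_trans _ h)// ler_piMr// invf_le1// ler1n.
rewrite normrM (le_trans _ (c_decay k.+1))// ler_piMr//.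
exact: norm_Re_exprz.
Qed.

Definition diffraction_density x : R := lim (series (diffraction_term x) @ \oo).

Lemma series_diff_le x m n : on_circle x -> (m <= n)%N ->
  `|series (diffraction_term x) n - series (diffraction_term x) m| <= D * (q ^+ m / (1 - q)).
Proof.
move=> x1 mn; rewrite sub_series_geq// (le_trans (ler_norm_sum _ _ _))//.
apply: (@le_trans _ _ (\sum_(m <= k < n) D * q ^+ k)).
  by apply: ler_sum => k _; exact: diffraction_term_le.
by rewrite -mulr_sumr ler_wpM2l// geometric_sum_le.
Qed.

Lemma diffraction_density_cvg x : on_circle x ->
  series (diffraction_term x) @ \oo --> diffraction_density x.
Proof.
move=> x1; apply: normed_cvg.
apply: (@series_le_cvg _ _ (geometric D q)).
- by move=> n; exact: normr_ge0.
- by move=> n; rewrite /geometric/= mulr_ge0// exprn_ge0// ltW.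
- by move=> n; exact: diffraction_term_le.
- by apply: is_cvg_geometric_series; rewrite ger0_norm ?ltW//; case/andP: q01.
Qed.

Lemma diffraction_density_tail x n : on_circle x ->
  `|series (diffraction_term x) n - diffraction_density x| <= D * (q ^+ n / (1 - q)).
Proof.
move=> x1; rewrite distrC.
have h : (fun m => `|series (diffraction_term x) m - series (diffraction_term x) n|) @ \oo -->
    `|diffraction_density x - series (diffraction_term x) n|.
  apply: cvg_norm; apply: cvgB; last exact: cvg_cst.
  exact: diffraction_density_cvg.
apply: (ler_cvg_to h (cvg_cst (D * (q ^+ n / (1 - q))))).
by exists n => // m /= nm; exact: series_diff_le.
Qed.

Lemma tail_cvg0 (S : R) : (fun n => S * (D * (q ^+ n.+1 / (1 - q)))) @ \oo --> 0.
Proof.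
rewrite -[X in _ --> X](mulr0 S); apply: cvgM; first exact: cvg_cst.
rewrite -[X in _ --> X](mulr0 D); apply: cvgM; first exact: cvg_cst.
rewrite -[X in _ --> X](mul0r (1 - q)^-1); apply: cvgM; last exact: cvg_cst.
rewrite (cvg_shiftS (fun n => q ^+ n)); apply: cvg_expr.
by rewrite ger0_norm ?ltW//; case/andP: q01.
Qed.

Lemma diffraction_abs_bound x : on_circle x ->
  exists C : R, forall K, zpsum (fun z => `|((c z) / 2)%:C * x ^ z|) K <= C%:C.
Proof.
(* A pair of indices [k], [-k] contributes [|c_k| <= D * q^k], and the index 0 only half of
   [|c_0|]. *)
move=> x1; exists (D / (1 - q)) => K.
have e z : `|((c z) / 2)%:C * x ^ z| = (`|c z| / 2)%:C.
  by rewrite normrM norm_exprz// mulr1 norm_realC normrM [`|2^-1|]ger0_norm.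
rewrite /zpsum; under eq_bigr do rewrite e.
rewrite -rmorph_sum/= lecR (symmetric_sumE (fun z => `|c z| / 2)).
apply: (@le_trans _ _ (\sum_(0 <= k < K.+1) D * q ^+ k)); last first.
  by rewrite -mulr_sumr ler_wpM2l// (le_trans (geometric_sum_le _ _))// expr0 div1r.
rewrite big_nat_recl// lerD//.
  have := c_decay 0; rewrite absz0; have := normr_ge0 (c 0); lra.
rewrite big_mkord; apply: ler_sum => k _; rewrite cN.
by have := c_decay k.+1%:Z; rewrite absz_nat; lra.
Qed.

Lemma diffraction_uniform (e : R) : 0 < e -> exists K0 : nat, forall K : nat,
  (K0 <= K)%N -> forall x, on_circle x ->
  `|zpsum (fun z => ((c z) / 2)%:C * x ^ z) K - (diffraction_density x)%:C| < e%:C.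
Proof.
move=> e0; have /cvgrPdist_lt /(_ _ e0) [K0 _ HK] := tail_cvg0 1.
exists K0 => K KK x x1; have := HK K KK; rewrite /= sub0r normrN mul1r => h.
rewrite zpsum_diffraction// -rmorphB/= norm_realC ltcR.
by rewrite (le_lt_trans (diffraction_density_tail _ _))// (le_lt_trans (ler_norm _)).
Qed.

Section TestFunction.
Variable l : R[i] -> R[i].
Hypothesis cl : continuous_on_circle l.
Let F t := conv_tilde l (circ t).
Let al := power l.

Let circle_circ (t : R) : on_circle (circ t). Proof. exact: norm_circ. Qed.

Lemma cint_circXz_conv z : cint (fun t => F t * circ t ^ z) = (al (- z))%:C.
Proof.
rewrite -(fourier_conv_tilde cl) /fourier haar_intE; apply: eq_cint => t _.
by rewrite conjE exprz_JN// conjcK.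
Qed.

Lemma bmeas_series K : bmeas (fun t : R => series (diffraction_term (circ t)) K).
Proof.
rewrite /series/=; elim: K => [|K IH].
  by under eq_fun do rewrite big_geq//; exact: bmeas_cst.
under eq_fun do rewrite big_nat_recr//=.
apply: bmeasD => //; case: K {IH} => [|K] /=; first exact: bmeas_cst.
by apply: bmeasM; [exact: bmeas_cst|have [] := cbmeas_circXz (R := R) K.+1].
Qed.

Lemma bmeas_density : bmeas (fun t : R => diffraction_density (circ t)).
Proof.
split.
  apply/measurable_EFinP.
  apply: (emeasurable_fun_cvg (fun n t => (series (diffraction_term (circ t)) n)%:E)).
    by move=> n; apply/measurable_EFinP; have [] := bmeas_series n.
  by move=> t _; apply: cvg_EFin; [exact: nearW|exact: diffraction_density_cvg].
exists (D / (1 - q)) => t; have := diffraction_density_tail 0 (circle_circ t).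
by rewrite /series/= big_geq// sub0r normrN expr0 div1r.
Qed.

Lemma cint_partial K : cint (fun t => F t * (series (diffraction_term (circ t)) K.+1)%:C) =
  (\sum_(i < K.*2.+1) al (i%:Z - K%:Z) * (c (i%:Z - K%:Z) / 2))%:C.
Proof.
have bF := cbmeas_conv_tilde cl.
transitivity (cint (fun t => \sum_(i < K.*2.+1)
    ((c (i%:Z - K%:Z)) / 2)%:C * (F t * circ t ^ (i%:Z - K%:Z)))).
  apply: eq_cint => t _; rewrite -zpsum_diffraction// mulr_sumr.
  by apply: eq_bigr => i _; rewrite mulrCA.
rewrite cint_sum; last first.
  move=> i; apply: cbmeasM; first exact: cbmeas_cst.
  by apply: cbmeasM => //; exact: cbmeas_circXz.
(* Integrating against [x^z] yields the coefficient at [-z]; reversing the symmetric sum and using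
   evenness of [c] absorbs the sign. *)
rewrite -(symmetric_sumN (fun z => al z * (c z / 2))) rmorph_sum/=.
apply: eq_bigr => i _; rewrite cintZ; last by apply: cbmeasM => //; exact: cbmeas_circXz.
by rewrite cint_circXz_conv -rmorphM/= cN mulrC.
Qed.

(** The error is at most the sup of a component of [l * ~l] times the uniform geometric tail. The
    partial integrals are real, so the imaginary part vanishes in the limit. *)
Lemma haar_int_density :
  (fun K => \sum_(i < K.*2.+1) al (i%:Z - K%:Z) * (c (i%:Z - K%:Z) / 2)) @ \oo -->
    Re (haar_int (fun x => conv_tilde l x * (diffraction_density x)%:C)) /\
  Im (haar_int (fun x => conv_tilde l x * (diffraction_density x)%:C)) = 0.
Proof.
have [bR bI] := cbmeas_conv_tilde cl.
have bd := bmeas_density.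
have conv (k : R -> R) : bmeas k ->
    (fun K => intI (fun t => k t * series (diffraction_term (circ t)) K.+1)) @ \oo -->
    intI (fun t => k t * diffraction_density (circ t)).
  move=> bk; have [_ [S kS]] := bk; have S0 : 0 <= S by apply: le_trans (kS 0).
  apply/cvgrPdist_lt => e e0.
  have /cvgrPdist_lt /(_ _ e0) := tail_cvg0 S; apply: filterS => K.
  rewrite sub0r normrN => hK; apply: le_lt_trans (le_lt_trans (ler_norm _) hK).
  rewrite distrC -RintegralB//; last 2 first.
  - by apply: bmeas_integrable; apply: bmeasM => //; exact: bmeas_series.
  - by apply: bmeas_integrable; apply: bmeasM.
  apply: le_int_bound => [|t _].
    by apply: bmeasB; apply: bmeasM => //; exact: bmeas_series.
  rewrite -mulrBr normrM ler_pM//; exact: diffraction_density_tail.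
have ReE (u : R[i]) (r : R) : Re (u * r%:C) = Re u * r.
  by case: u => a b /=; rewrite mulr0 subr0.
have ImE (u : R[i]) (r : R) : Im (u * r%:C) = Im u * r.
  by case: u => a b /=; rewrite mulr0 add0r.
have part K := cint_partial K.
rewrite haar_intE; split.
  have -> : Re (cint (fun t => F t * (diffraction_density (circ t))%:C)) =
      intI (fun t => Re (F t) * diffraction_density (circ t)).
    by apply: eq_Rintegral => t _; rewrite ReE.
  suff -> : (fun K => \sum_(i < K.*2.+1) al (i%:Z - K%:Z) * (c (i%:Z - K%:Z) / 2)) =
      (fun K => intI (fun t => Re (F t) * series (diffraction_term (circ t)) K.+1)).
    exact: conv.
  apply/funext => K; have := congr1 (@complex.Re R) (part K) => /= <-.
  by apply: eq_Rintegral => t _; rewrite mulr0 subr0.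
have -> : Im (cint (fun t => F t * (diffraction_density (circ t))%:C)) =
    intI (fun t => Im (F t) * diffraction_density (circ t)).
  by apply: eq_Rintegral => t _; rewrite ImE.
have h := conv _ bI.
have h0 : (fun K => intI (fun t => Im (F t) * series (diffraction_term (circ t)) K.+1)) = fun=> 0.
  apply/funext => K; have := congr1 (@complex.Im R) (part K) => /= <-.
  by apply: eq_Rintegral => t _; rewrite mulr0 add0r.
rewrite h0 in h; exact: (cvg_unique _ h (cvg_cst 0)).
Qed.

(** The constant [m2 / 2] multiplies the Parseval sum, giving the value at 1, that is, the Dirac
    mass; the [c_z / 2] give the density. Absolute convergence holds since the masses are bounded
    and the [power z] are summable. *)
Lemma diffraction_zsum (m2 : R) :
  zsum_to (fun z => fourier (conv_tilde l) z * (2^-1 * (m2 + c z))%:C)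
    ((2^-1 * m2)%:C * conv_tilde l 1 +
     haar_int (fun x => conv_tilde l x * (diffraction_density x)%:C)).
Proof.
have [sum_le sum_cvg] := power_sum_cvg cl.
have [hRe hIm] := haar_int_density.
have uE z : fourier (conv_tilde l) z * (2^-1 * (m2 + c z))%:C =
    (al z * (2^-1 * (m2 + c z)))%:C.
  by rewrite (fourier_conv_tilde cl) -rmorphM.
have zE N : zpsum (fun z => fourier (conv_tilde l) z * (2^-1 * (m2 + c z))%:C) N =
    (\sum_(i < N.*2.+1) al (i%:Z - N%:Z) * (2^-1 * (m2 + c (i%:Z - N%:Z))))%:C.
  by rewrite /zpsum rmorph_sum/=; apply: eq_bigr => i _; rewrite uE.
have p1 := conv_tilde1 l.
set hi := haar_int _ in hRe hIm *.
split.
- have D2 z : `|2^-1 * (m2 + c z)| <= `|m2| + D.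
    have h1 := ler_normD m2 (c z); have h2 := c_decay z.
    have h3 : D * q ^+ `|z| <= D.
      by rewrite ler_piMr// exprn_ile1 ?(ltW q0)//; case/andP: q01 => _ /ltW.
    rewrite normrM [`|2^-1|]ger0_norm//; have := normr_ge0 (m2 + c z); lra.
  exists ((`|m2| + D) * Re (conv_tilde l 1)) => N.
  rewrite /zpsum; under eq_bigr do rewrite uE norm_realC.
  rewrite -rmorph_sum/= lecR.
  apply: (@le_trans _ _ (\sum_(i < N.*2.+1) (`|m2| + D) * al (i%:Z - N%:Z))).
    apply: ler_sum => i _; rewrite normrM ger0_norm ?power_ge0// mulrC.
    by rewrite ler_wpM2r ?power_ge0.
  by rewrite -mulr_sumr ler_wpM2l ?addr_ge0.
- have -> : (fun N => Re (zpsum (fun z => fourier (conv_tilde l) z * (2^-1 * (m2 + c z))%:C) N)) =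
      (fun N => 2^-1 * m2 * (\sum_(i < N.*2.+1) al (i%:Z - N%:Z)) +
         \sum_(i < N.*2.+1) al (i%:Z - N%:Z) * (c (i%:Z - N%:Z) / 2)).
    apply/funext => N; rewrite zE/= mulr_sumr -big_split/=; apply: eq_bigr => i _.
    by field.
  have -> : Re ((2^-1 * m2)%:C * conv_tilde l 1 + hi) =
      2^-1 * m2 * Re (conv_tilde l 1) + Re hi.
    by rewrite p1; case: hi {hRe hIm} => a b /=; rewrite mul0r subr0.
  by apply: cvgD => //; apply: cvgM => //; exact: cvg_cst.
- have -> : (fun N => Im (zpsum (fun z => fourier (conv_tilde l) z * (2^-1 * (m2 + c z))%:C) N)) =
      fun=> 0 by apply/funext => N; rewrite zE.
  have -> : Im ((2^-1 * m2)%:C * conv_tilde l 1 + hi) = 0.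
    by rewrite p1; case: hi hIm {hRe} => a b /= ->; rewrite mulr0 mul0r !addr0.
  exact: cvg_cst.
Qed.

End TestFunction.
End Diffraction.

Unset Implicit Arguments.

Theorem theorem3p2 (R : realType) (T : R -> R) (parts : seq (interval R))
    (h : R -> R) (Psi : (R -> R) -> (R -> R)) (M q : R) (f : R -> R) :
  maps_unit_interval T ->
  piecewise_monotonic T parts ->
  T_invariant T h ->
  mixing T h ->
  spectral_decomposition T parts h Psi M q ->
  BV f ->
  (forall x, I01 x -> 0 <= f x) ->
  (exists C : R, forall x, I01 x -> `|f x| <= C) ->
  exists N : set R, [/\ measurable N, eta_h h N = 0%E &
    forall y : R, I01 y -> ~ N y ->
    exists gam : int -> R,
      [/\ (forall z : int,
             autocorr_approx (return_weights T f y) n z @[n --> \oo] --> gam z),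
          (forall z : int,
             2 * gam z = (int_eta h f) ^+ 2 + coef_c Psi h f z)
        & exists g : R[i] -> R[i],
          [/\ (forall x : R[i], on_circle x ->
                 exists C : R, forall K : nat,
                   zpsum (fun z => `|((coef_c Psi h f z) / 2)%:C * x ^ z|) K
                     <= C%:C),
              (forall e : R, 0 < e -> exists K0 : nat, forall K : nat,
                 (K0 <= K)%N -> forall x : R[i], on_circle x ->
                 `|zpsum (fun z => ((coef_c Psi h f z) / 2)%:C * x ^ z) K - g x|
                   < e%:C)
            & forall l : R[i] -> R[i], continuous_on_circle l ->
                zsum_to (fun z => fourier (conv_tilde l) z * (gam z)%:C)
                  ((2^-1 * (int_eta h f) ^+ 2)%:C * conv_tilde l 1
                   + haar_int (fun x => conv_tilde l x * g x))]]].
Proof.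
move=> Tmaps Tpm _ _ SD Bf _ fC.
have [N [mN N0 HN]] := autocorrelation_ae Tmaps Tpm SD Bf fC.
have [D D0 HD] := coef_c_decay SD Bf fC.
have q01 : 0 < q < 1 by case: SD => _ _ _ [].
exists N; split => // y Iy Ny.
exists (fun z => 2^-1 * (int_eta h f ^+ 2 + coef_c Psi h f z)); split.
- exact: HN.
- by move=> z; rewrite mulrA divff ?mul1r ?pnatr_eq0.
exists (fun x => (diffraction_density (coef_c Psi h f) x)%:C); split.
- exact: (diffraction_abs_bound q01 D0 HD (coef_cN h Psi f)).
- exact: (diffraction_uniform q01 D0 HD (coef_cN h Psi f)).
- move=> l cl; exact: (diffraction_zsum q01 D0 HD (coef_cN h Psi f) cl).
Qed.
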